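(* Let $\alpha_0=\frac{2}{5}$, $\alpha_1=\frac{1}{5}$, $\alpha_2=\frac{1}{10}$. Then the Sasano system of type $A_4^{(2)}$ $$\dot x=4xy-2\alpha_1+2zw,\quad \dot y=-2y^2-4x-2t-w,\quad \dot z=z^2-w+x+2yz,\quad \dot w=-2zw-\alpha_0-2yw$$ is not integrable by rational first integrals. That is, the associated autonomous Hamiltonian system with three degrees of freedom, with Hamiltonian $\widehat H=H+F$ in the variables $(x,y,z,w,t,F)$, does not admit three functionally independent first integrals in involution that are rational functions of $(x,y,z,w,t,F)$.
   Context: The parameters $\alpha_0,\alpha_1,\alpha_2\in\mathbb{C}$ of the Sasano system of type $A_4^{(2)}$ satisfy $\alpha_0+2\alpha_1+2\alpha_2=1$. The system is the time-dependent Hamiltonian system $\dot x=\partial H/\partial y$, $\dot y=-\partial H/\partial x$, $\dot z=\partial H/\partial w$, $\dot w=-\partial H/\partial z$ (dot $=d/dt$) with $$H=2xy^2+2x^2+2tx-2\alpha_1y+z^2w-\tfrac{w^2}{2}+\alpha_0z+xw+2yzw.$$ It is extended to an autonomous Hamiltonian system on $\mathbb{C}^6$ with coordinates $(x,y,z,w,t,F)$ and Hamiltonian $\widehat H=H+F$: $$\frac{dx}{ds}=\frac{\partial\widehat H}{\partial y},\ \frac{dy}{ds}=-\frac{\partial\widehat H}{\partial x},\ \frac{dz}{ds}=\frac{\partial\widehat H}{\partial w},\ \frac{dw}{ds}=-\frac{\partial\widehat H}{\partial z},\ \frac{dt}{ds}=\frac{\partial\widehat H}{\partial F},\ \frac{dF}{ds}=-\frac{\partial\widehat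 H}{\partial t},$$ with canonical symplectic form $\Omega=dy\wedge dx+dw\wedge dz+dF\wedge dt$. ''Integrable by rational first integrals'' means complete (Liouville--Arnold) integrability of this extended system: existence of three functionally independent first integrals, rational in $(x,y,z,w,t,F)$, pairwise in involution with respect to the Poisson bracket of $\Omega$. *)

(* Defs.v *)
From HB Require Import structures.
From mathcomp Require Import all_boot all_order all_algebra generic_quotient.
From mathcomp Require Import complex mpoly ring.

Set Implicit Arguments.
Unset Strict Implicit.
Unset Printing Implicit Defensive.

Import GRing.Theory Num.Theory.
Local Open Scope ring_scope.

Local Notation "x %:F" := (@FracField.tofrac _ x).

Fact quotient_rule_aux (R : comPzRingType) (p q a b p' q' a' b' : R) :
  (p' * q - p * q') * b ^+ 2 - (a' * b - a * b') * q ^+ 2 =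
  b * q * (p' * b + p * b') - b * q * (a' * q + a * q')
  - (p * b - a * q) * (q' * b + b' * q).
Proof. by ring. Qed.

Section RationalFunctions.
Variables (K : numFieldType) (m : nat).
Implicit Types (f g : {fraction {mpoly K[m]}}) (p q : {mpoly K[m]}).

(* The quotient rule; by [pderivE] below it holds for every way of writing f as
   a quotient, not only for the representative picked by [repr]. *)
Definition pderiv (i : 'I_m) f : {fraction {mpoly K[m]}} :=
  let p := \n_(repr f) in let q := \d_(repr f) in
  (p^`M(i) * q - p * q^`M(i))%:F / (q ^+ 2)%:F.

Lemma fracE f : f = (\n_(repr f))%:F / (\d_(repr f))%:F.
Proof.
set r := repr f; have r2 : \d_r != 0 := denom_ratioP r.
have r2F : (\d_r)%:F != 0 by rewrite tofrac_eq0.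
apply: (mulIf r2F); rewrite divfK // -[f]reprK -/r.
unlock FracField.tofrac; rewrite -[LHS]FracField.pi_mul.
apply/eqmodP; rewrite /= FracField.equivfE /FracField.mulf.
by rewrite !numden_Ratio ?mulf_neq0 ?oner_neq0 ?denom_ratioP //= !mulr1 mulrC.
Qed.

Lemma frac_eqE p q a b : q != 0 -> b != 0 ->
  (p%:F / q%:F == a%:F / b%:F) = (p * b == a * q).
Proof.
rewrite -(tofrac_eq0 q) -(tofrac_eq0 b) => qF bF.
by rewrite (eqr_div _ _ qF bF) -(tofracM p b) -(tofracM a q) tofrac_eq.
Qed.

Lemma pderivE i p q : q != 0 ->
  pderiv i (p%:F / q%:F) = (p^`M(i) * q - p * q^`M(i))%:F / (q ^+ 2)%:F.
Proof.
move=> q0; rewrite /pderiv; set f := p%:F / q%:F.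
have := fracE f; have := denom_ratioP (repr f).
move: (\n_(repr f)) (\d_(repr f)) => a b b0 /eqP.
rewrite {1}/f (frac_eqE _ _ q0 b0) => /eqP pb_aq.
apply/eqP; rewrite (frac_eqE _ _ (expf_neq0 2 b0) (expf_neq0 2 q0)).
have /(congr1 (fun r => b * q * r)) := congr1 (mderiv i) pb_aq.
rewrite !mderivM => dE; rewrite eq_sym -subr_eq0.
set a' := mderiv i a in dE *; set b' := mderiv i b in dE *.
set p' := mderiv i p in dE *; set q' := mderiv i q in dE *.
rewrite (quotient_rule_aux p q a b p' q' a' b').
by rewrite pb_aq dE !subrr mul0r subr0.
Qed.

(* Meaningless where the denominator picked by [repr] vanishes. *)
Definition rfeval (v : 'I_m -> K) f : K :=
  (\n_(repr f)).@[v] / (\d_(repr f)).@[v].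

(* Linear independence of df_0, ..., df_(k-1) at every point of a nonempty
   (hence dense) Zariski-open set {g != 0}. Multiplying g by the denominators
   of the partial derivatives, one may assume that they do not vanish there. *)
Definition functionally_independent k (f : 'I_k -> {fraction {mpoly K[m]}}) :=
  exists2 g : {mpoly K[m]}, g != 0 &
    forall v : 'I_m -> K, g.@[v] != 0 ->
      row_free (\matrix_(a < k, i < m) rfeval v (pderiv i (f a))).

End RationalFunctions.

Section Hamiltonian.
Variables (K : numFieldType) (n : nat).
Local Notation rf := {fraction {mpoly K[n + n]}}.

(* Canonical coordinates on K^(2n) are ordered (q_1, ..., q_n, p_1, ..., p_n). *)
Definition qidx (k : 'I_n) : 'I_(n + n) := lshift n k.
Definition pidx (k : 'I_n) : 'I_(n + n) := rshift n k.

(* Bracket of \sum_k dp_k /\ dq_k. *)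
Definition poisson (f g : rf) : rf :=
  \sum_(k < n) (pderiv (qidx k) f * pderiv (pidx k) g
                - pderiv (pidx k) f * pderiv (qidx k) g).

Definition hamiltonian_field (H : {mpoly K[n + n]}) (j : 'I_(n + n)) :
    {mpoly K[n + n]} :=
  match split j with
  | inl k => H^`M(pidx k)
  | inr k => - H^`M(qidx k)
  end.

Lemma hamiltonian_field_q H k : hamiltonian_field H (qidx k) = H^`M(pidx k).
Proof. by rewrite /hamiltonian_field (unsplitK (inl k)). Qed.

Lemma hamiltonian_field_p H k : hamiltonian_field H (pidx k) = - H^`M(qidx k).
Proof. by rewrite /hamiltonian_field (unsplitK (inr k)). Qed.

Definition first_integral (H : {mpoly K[n + n]}) (f : rf) : Prop :=
  \sum_(j < n + n) (hamiltonian_field H j)%:F * pderiv j f = 0.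

Definition rationally_integrable (H : {mpoly K[n + n]}) : Prop :=
  exists f : 'I_n -> rf,
    [/\ forall a, first_integral H (f a),
        forall a b, poisson (f a) (f b) = 0
      & functionally_independent f].

End Hamiltonian.

Section Sasano.
Variable K : numFieldType.

Local Notation i0 := (@Ordinal 3 0 isT).
Local Notation i1 := (@Ordinal 3 1 isT).
Local Notation i2 := (@Ordinal 3 2 isT).

(* Conjugate pairs (q, p) are (x, y), (z, w) and (t, F). *)
Definition sx : {mpoly K[3 + 3]} := 'X_(qidx i0).
Definition sy : {mpoly K[3 + 3]} := 'X_(pidx i0).
Definition sz : {mpoly K[3 + 3]} := 'X_(qidx i1).
Definition sw : {mpoly K[3 + 3]} := 'X_(pidx i1).
Definition st : {mpoly K[3 + 3]} := 'X_(qidx i2).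
Definition sF : {mpoly K[3 + 3]} := 'X_(pidx i2).

Definition sasano_H (alpha0 alpha1 : K) : {mpoly K[3 + 3]} :=
  2 * sx * sy ^+ 2 + 2 * sx ^+ 2 + 2 * st * sx - 2 * alpha1%:MP * sy
  + sz ^+ 2 * sw - (2^-1)%:MP * sw ^+ 2 + alpha0%:MP * sz + sx * sw + 2 * sy * sz * sw.

Definition sasano_Hhat (alpha0 alpha1 : K) := sasano_H alpha0 alpha1 + sF.

Fact sasano_aux (R : comPzRingType) (x y z w t a b dx dy dz dw dt dF : R) :
  (0 * x + 2 * dx) * (y * y) + 2 * x * (dy * y + y * dy)
  + (0 * (x * x) + 2 * (dx * x + x * dx))
  + ((0 * t + 2 * dt) * x + 2 * t * dx)
  - ((0 * b + 2 * 0) * y + 2 * b * dy)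
  + ((dz * z + z * dz) * w + z * z * dw)
  - (0 * (w * w) + dw * w) + (0 * z + a * dz)
  + (dx * w + x * dw)
  + (((0 * y + 2 * dy) * z + 2 * y * dz) * w + 2 * y * z * dw) + dF =
  (2 * (y * y) + 4 * x + 2 * t + w) * dx
  + (4 * x * y - 2 * b + 2 * z * w) * dy
  + (2 * z * w + a + 2 * y * w) * dz
  + (z * z - w + x + 2 * y * z) * dw + 2 * x * dt + dF.
Proof. by ring. Qed.

Lemma mderiv_sasano_Hhat (alpha0 alpha1 : K) i
    (d := fun j => (i == j)%:R : {mpoly K[3 + 3]}) :
  (sasano_Hhat alpha0 alpha1)^`M(i) =
    (2 * sy ^+ 2 + 4 * sx + 2 * st + sw) * d (qidx i0)
    + (4 * sx * sy - 2 * alpha1%:MP + 2 * sz * sw) * d (pidx i0)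
    + (2 * sz * sw + alpha0%:MP + 2 * sy * sw) * d (qidx i1)
    + (sz ^+ 2 - sw + sx + 2 * sy * sz) * d (pidx i1)
    + 2 * sx * d (qidx i2) + d (pidx i2).
Proof.
have dX j : ('X_j : {mpoly K[3 + 3]})^`M(i) = d j.
  rewrite mderivX mnm1E eq_sym /d.
  case: eqP => [->|_]; last by rewrite scale0r.
  rewrite scale1r (_ : _ - _ = 0)%MM ?mpolyX0 //.
  by apply/mnmP => k; rewrite mnmBE subnn mnm0E.
have dN k : (k%:R : {mpoly K[3 + 3]})^`M(i) = 0.
  by rewrite -mpolyC_nat mderivC.
have half (u v : {mpoly K[3 + 3]}) : (2^-1)%:MP * (u * v + v * u) = u * v.
  rewrite [v * u]mulrC mulrDr -mulrDl -mpolyCD.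
  by rewrite -{1 2}[2^-1]mul1r -splitr mpolyC1 mul1r.
rewrite /sasano_Hhat /sasano_H /sx /sy /sz /sw /st /sF.
rewrite !(expr2, mderivB, mderivD, mderivM, mderivC, dN, dX) half.
exact: sasano_aux.
Qed.

Lemma sasano_system (alpha0 alpha1 : K) (H := sasano_Hhat alpha0 alpha1) :
  [/\ hamiltonian_field H (qidx i0) =
        4 * sx * sy - 2 * alpha1%:MP + 2 * sz * sw,
      hamiltonian_field H (pidx i0) = - 2 * sy ^+ 2 - 4 * sx - 2 * st - sw,
      hamiltonian_field H (qidx i1) = sz ^+ 2 - sw + sx + 2 * sy * sz,
      hamiltonian_field H (pidx i1) =
        - 2 * sz * sw - alpha0%:MP - 2 * sy * sw
    & hamiltonian_field H (qidx i2) = 1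
      /\ hamiltonian_field H (pidx i2) = - 2 * sx].
Proof.
rewrite !hamiltonian_field_q !hamiltonian_field_p !mderiv_sasano_Hhat.
rewrite !(eq_lshift, eq_rshift, eq_lrshift, eq_rlshift) /=.
rewrite !(mulr0, mulr1, addr0, add0r).
by split; last split; rewrite ?(opprD, mulNr, addrA).
Qed.

End Sasano.

(* Main.v *)
(* The system has the solution [x = w = -2t/5], [y = z = 0]. With
   [rho = 1 / sqrt 5], the variational equations along it split into two Airy
   equations [u'' = (2 + 6 rho) t u] and [v'' = (2 - 6 rho) t v], whose
   coefficients have opposite signs. Write a rational first integral in lowest
   terms p/q; then p and q are Darboux polynomials with a common cofactor. The
   part of lowest degree in the variations of a Darboux polynomial is a Darboux
   polynomial of the variational equations. With [t = s^2] and in WKB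
   coordinates [u', v' +- sqrt(2 +- 6 rho) s u, v], its expansion at
   [s = oo] is resonant only in products [u_+ u_-], [v_+ v_-], since the two
   frequencies are incommensurable; the first subleading order, together with
   polynomiality in [t], forces it to have degree 0 and to depend on the energy
   alone. Subtracting multiples, p/q itself is a function of the energy, so the
   gradients of any two rational first integrals are parallel. *)
From HB Require Import structures.
Require Import Defs.
From mathcomp Require Import all_boot all_order all_algebra.
From mathcomp Require Import reals complex mpoly.
From mathcomp Require Import generic_quotient boolp ring zify.

Set Implicit Arguments.
Unset Strict Implicit.
Unset Printing Implicit Defensive.

Import Order.TTheory GRing.Theory Num.Theory.
Local Open Scope ring_scope.


(** * Lowest terms over polynomial rings *)

(** The variations of y and z satisfy (y, z)'' = t M (y, z) with 5 M = [[28, 12], [-12, -8]]. The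
    eigenvalues of M are 2 + 6 rho and 2 - 6 rho; its eigenvectors (2, 5 rho - 3) and (2, - 5 rho -
    3) are the coefficients of [eta] and [zeta]. Degree 0 results from two opposite counts. WKB
    solutions have amplitude t^(-1/4) = s^(-1/2), so a resonant product of degree k decays like
    s^(-k/2), and a conserved quantity compensates it by s^n with 2 n = k. On the other hand, where
    u = v = 0 the variations of y and z vanish and those of x and w carry a factor s, so that an
    expression polynomial in the original coordinates has n >= k there. Together these give k = n =
    0. All energies are treated at once: the energy is the variable of the coefficient ring
    [{poly K}], and a part of degree 0 in the variations and in s is a polynomial in it. *)

Section Divisibility.
Variable R : idomainType.
Implicit Types a b c d e g x : R.

Definition divides a b := exists c, b = c * a.

(** Cancellation, rather than the absence of common divisors, is what extracts [q] divides D q from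
    q * D p = p * D q. *)
Definition coprime_to a b := forall x, divides a (b * x) -> divides a x.

Lemma divides_refl a : divides a a.
Proof. by exists 1; rewrite mul1r. Qed.

Lemma divides_mull a b c : divides a b -> divides a (c * b).
Proof. by case=> d ->; exists (c * d); rewrite mulrA. Qed.

Lemma divides_mulr a b c : divides a b -> divides a (b * c).
Proof. by rewrite mulrC; exact: divides_mull. Qed.

Lemma dividesD a b c : divides a b -> divides a c -> divides a (b + c).
Proof. by move=> [d ->] [e ->]; exists (d + e); rewrite mulrDl. Qed.

Lemma dividesB a b c : divides a b -> divides a c -> divides a (b - c).
Proof. by move=> [d ->] [e ->]; exists (d - e); rewrite mulrBl. Qed.

Lemma divides_trans a b c : divides a b -> divides b c -> divides a c.
Proof. by move=> [d ->] [e ->]; exists (e * d); rewrite mulrA. Qed.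

Lemma divides_mul2l a b c : a != 0 -> divides (a * b) (a * c) -> divides b c.
Proof.
move=> a0 [d E]; exists d; apply: (mulfI a0).
by rewrite E mulrCA.
Qed.

Lemma divides1 a b : divides a 1 -> divides a b.
Proof. by move=> /(divides_mulr b); rewrite mul1r. Qed.

End Divisibility.

(** The gcd-domain property, in a form that passes from a ring to its polynomial ring. *)
Definition has_lowest_terms (R : idomainType) :=
  forall a b : R, b != 0 ->
    exists g a' b', [/\ a = g * a', b = g * b' & coprime_to b' a'].

Section LowestTerms.
Variable R : idomainType.
Implicit Types a b c d e g x : R.

Lemma coprime_common_divisor a b e :
  b != 0 -> coprime_to b a -> divides e a -> divides e b -> divides e 1.
Proof.
move=> b0 ba [a1 Ea] [b1 Eb].
have b10 : b1 != 0 by apply: contraNneq b0 => E; rewrite Eb E mul0r.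
have /ba[c Ec] : divides b (a * b1).
  by exists a1; rewrite Ea Eb -mulrA (mulrC e).
exists c; apply: (mulfI b10); rewrite mulr1 {1}Ec Eb.
by rewrite mulrCA.
Qed.

Lemma lowest_terms_gcd (ltR : has_lowest_terms R) a b : b != 0 ->
  exists g a' b', [/\ a = g * a', b = g * b' &
    forall e, divides e a' -> divides e b' -> divides e 1].
Proof.
move=> b0; have [g [a' [b' [Ea Eb ba]]]] := ltR a b b0.
exists g, a', b'; split=> // e; apply: coprime_common_divisor => //.
by apply: contraNneq b0 => E; rewrite Eb E mulr0.
Qed.

End LowestTerms.

Section Gauss.
Variable R : idomainType.
Hypothesis ltR : has_lowest_terms R.
Implicit Types (c d e : R) (p q : {poly R}).

Lemma divides_polyC c p : divides c%:P p <-> forall i, divides c p`_i.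
Proof.
split=> [[q ->] i|dp]; first by exists q`_i; rewrite coefMC.
elim/poly_ind: p dp => [|p a IH] dp; first by exists 0; rewrite mul0r.
have [q Eq] : divides c%:P p.
  by apply: IH => i; have := dp i.+1; rewrite coefD coefC addr0 coefMX.
have [b Eb] := dp 0%N; move: Eb; rewrite coefD coefC coefMX /= add0r => Eb.
by exists (q * 'X + b%:P); rewrite mulrDl Eq Eb polyCM mulrAC.
Qed.

(* Gauss's lemma: [d], the gcd of [c] and the leading coefficient of [p], is
   removed from [q] by induction on [p], and [c / d] by induction on [q]. *)
Lemma gauss_lemma c p q :
    (forall e, divides e c -> divides e%:P p -> divides e 1) ->
  divides c%:P (p * q) -> divides c%:P q.
Proof.
have [n] := ubnP (size p + size q); elim: n c p q => // n IH c p q ltn cp cpq.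
have [p0|p0] := eqVneq p 0.
  suff [u Eu] : divides c 1.
    by apply: divides1; exists u%:P; rewrite -polyCM -Eu.
  by apply: cp (divides_refl c) _; rewrite p0; exists 0; rewrite mul0r.
have [->|q0] := eqVneq q 0; first by exists 0; rewrite mul0r.
have [c0|c0] := eqVneq c 0.
  move: cpq => [r /eqP]; rewrite c0 mulr0 mulf_eq0 (negPf p0) (negPf q0) //.
pose a := lead_coef p; pose b := lead_coef q.
have [d [a' [c' [Ea Ec c'a']]]] := ltR a c0.
have [d0 c'0] : d != 0 /\ c' != 0.
  by move: c0; rewrite Ec mulf_eq0 negb_or => /andP.
have dc : divides d c by exists c'; rewrite Ec mulrC.
have c'c : divides c' c by exists d.
have sz_tail (r : {poly R}) : r != 0 ->
    (size (r - lead_coef r *: 'X^((size r).-1))%R < size r)%N.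
  move=> r0; have sr : (0 < size r)%N by rewrite size_poly_gt0.
  rewrite -{2}(prednK sr) ltnS; apply/leq_sizeP => j jge.
  rewrite coefB coefZ coefXn; case: eqP => [->|/eqP jne].
    by rewrite mulr1 lead_coefE subrr.
  rewrite mulr0 subr0 nth_default // -(prednK sr).
  by rewrite ltn_neqAle eq_sym jne.
have c'b : divides c' b.
  apply: c'a'; apply: (divides_mul2l d0); rewrite mulrA -Ea -Ec.
  have /divides_polyC/(_ (size (p * q)).-1) := cpq.
  by rewrite -lead_coefE lead_coefM.
have dvdCZ e x (r s : {poly R}) :
    divides e x -> divides e%:P (r * (x *: s)).
  move=> [y ->]; exists (y *: (r * s)).
  by rewrite -!mul_polyC polyCM; ring.
have [q2 Eq] : divides c'%:P q.
  rewrite -(subrK (b *: 'X^((size q).-1)) q); apply: dividesD.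
    apply: (IH _ p).
    - by rewrite -ltnS (leq_trans _ ltn) // ltnS ltn_add2l sz_tail.
    - by move=> e ec' ep; apply: cp ep; apply: divides_trans c'c.
    - rewrite mulrBr; apply: dividesB; last exact: dvdCZ.
      apply: divides_trans cpq; case: c'c => x ->; exists x%:P.
      by rewrite polyCM.
  by have := dvdCZ c' b 1 'X^((size q).-1) c'b; rewrite mul1r.
have szq2 : size q2 = size q.
  by rewrite Eq mulrC mul_polyC size_scale.
have [q3 Eq2] : divides d%:P q2.
  apply: (IH _ (p - a *: 'X^((size p).-1))).
  - by rewrite szq2 -ltnS (leq_trans _ ltn) // ltnS ltn_add2r sz_tail.
  - move=> e ed ep; apply: cp; first exact: divides_trans ed dc.
    rewrite -(subrK (a *: 'X^((size p).-1)) p); apply: dividesD => //.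
    have /(dvdCZ e a 1 'X^((size p).-1)) : divides e a.
      by apply: divides_trans ed _; exists a'; rewrite Ea mulrC.
    by rewrite mul1r.
  - rewrite mulrBl; apply: dividesB.
      have c'P0 : c'%:P != 0 :> {poly R} by rewrite polyC_eq0.
      apply: (divides_mul2l c'P0); rewrite -polyCM (mulrC c') -Ec.
      by move: cpq; rewrite Eq; congr divides; ring.
    rewrite mulrC; apply: dvdCZ; exists a'; by rewrite Ea mulrC.
by exists q3; rewrite Eq Eq2 Ec polyCM mulrA.
Qed.

Definition primitive p := forall e, divides e%:P p -> divides e 1.

Lemma primitive_cancel c p q :
  primitive p -> divides c%:P (p * q) -> divides c%:P q.
Proof. by move=> pp; apply: gauss_lemma => e _; apply: pp. Qed.

Lemma primitive_neq0 p : primitive p -> p != 0.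
Proof.
move=> pp; apply/eqP => p0; have [|u /eqP] := pp 0.
  by exists 0; rewrite p0 mul0r.
by rewrite mulr0 oner_eq0.
Qed.

(** The content is built along the Horner form: for p * 'X + a it is the gcd of [a] and the content
    of p. *)
Lemma primitive_part p : p != 0 ->
  exists c p', p = c%:P * p' /\ primitive p'.
Proof.
elim/poly_ind: p => [|p a IH]; first by rewrite eqxx.
have [->|p0 _] := eqVneq p 0.
  rewrite mul0r add0r polyC_eq0 => a0; exists a, 1; rewrite mulr1; split=> // e.
  by move/divides_polyC/(_ 0%N); rewrite coef1.
have [c [p' [Ep pp']]] := IH p0.
have c0 : c != 0.
  by apply: contraNneq p0 => E; rewrite Ep E mul0r.
have [g [a' [c' [Ea Ec co]]]] := lowest_terms_gcd ltR a c0.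
exists g, (c'%:P * p' * 'X + a'%:P); split.
  by rewrite Ep Ec Ea !polyCM mulrDr !mulrA.
move=> e /divides_polyC de; apply: co.
  by have := de 0%N; rewrite coefD coefC coefMX add0r.
have : divides e%:P (p' * c'%:P).
  apply/divides_polyC => i; have := de i.+1.
  by rewrite coefD coefC coefMX addr0 mulrC.
by move/(primitive_cancel pp')/divides_polyC/(_ 0%N); rewrite coefC.
Qed.

End Gauss.

Section PolyLowestTerms.
Variable R : idomainType.
Hypothesis ltR : has_lowest_terms R.
Implicit Types (c d e : R) (p q : {poly R}).

(* Among the pairs with [a * q = b * p], one with [b] of least degree has, once
   made primitive, [b] dividing all the others, by pseudo-division. *)
Lemma poly_lowest_terms : has_lowest_terms {poly R}.
Proof.
move=> P Q Q0.
have [->|P0] := eqVneq P 0.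
  by exists Q, 0, 1; rewrite mulr0 mulr1; split=> // x _; exists x; rewrite mulr1.
have [e [p [EP pp]]] := primitive_part ltR P0.
have [d [q [EQ pq]]] := primitive_part ltR Q0.
have p0 := primitive_neq0 pp; have q0 := primitive_neq0 pq.
pose J (b : {poly R}) := exists a : {poly R}, a * q = b * p.
have [b0 [b0n0 Jb0 b0min]] : exists b, [/\ b != 0, J b &
    forall b', J b' -> (size b' < size b)%N -> b' = 0].
  have Jq : J q by exists p; rewrite mulrC.
  suff min n b : b != 0 -> J b -> (size b < n)%N -> exists b, [/\ b != 0, J b &
      forall b', J b' -> (size b' < size b)%N -> b' = 0].
    exact: min q0 Jq (ltnSn _).
  elim: n b => // n IH b bn0 Jb ltn.
  have [[b' [b'0 Jb' ltb']]|noJ] :=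
      pselect (exists b', [/\ b' != 0, J b' & (size b' < size b)%N]).
    by apply: (IH b') => //; apply: leq_trans ltb' _.
  exists b; split=> // b' Jb' ltb'; apply: contra_notP noJ => /eqP b'0.
  by exists b'.
have [c [b [Eb pb]]] := primitive_part ltR b0n0.
have bn0 := primitive_neq0 pb.
have c0 : c != 0 by apply: contraNneq b0n0 => E; rewrite Eb E mul0r.
have Jb : J b.
  have [a Ea] := Jb0; suff [a1 Ea1] : divides c%:P a.
    exists a1; apply: (@mulfI _ c%:P); first by rewrite polyC_eq0.
    by rewrite [RHS]mulrA -Eb -Ea Ea1; ring.
  apply: (primitive_cancel ltR pq); rewrite mulrC Ea Eb -mulrA mulrC.
  by exists (b * p).
have bdvd b' : J b' -> divides b b'.
  move=> Jb'; have lb0 : lead_coef b != 0 by rewrite lead_coef_eq0.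
  have := Pdiv.Idomain.divp_eq b' b.
  set k := scalp b' b; set u := b' %/ b; set r := b' %% b => E.
  (* The pseudo-remainder is again in [J] and has degree below that of [b0]. *)
  have r0 : r = 0.
    apply: b0min; last by rewrite Eb mul_polyC size_scale // ltn_modp.
    have [a Ea] := Jb; have [a' Ea'] := Jb'.
    exists (lead_coef b ^+ k *: a' - u * a); rewrite mulrBl -scalerAl Ea'.
    by rewrite -mulrA Ea scalerAl E; ring.
  have lk : lead_coef b ^+ k != 0 by rewrite expf_neq0.
  have [v Ev] : divides (lead_coef b ^+ k)%:P u.
    apply: (primitive_cancel ltR pb); exists b'.
    by rewrite mulrC [RHS]mulrC mul_polyC E r0 addr0.
  exists v; apply: (@mulfI _ (lead_coef b ^+ k)%:P); rewrite ?polyC_eq0 //.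
  by rewrite mul_polyC E r0 addr0 Ev; ring.
have [a Ea] := Jb.
have [G EG] : divides b q by apply: bdvd; exists p; rewrite mulrC.
have Ep : p = a * G.
  by apply: (mulfI bn0); rewrite -Ea EG; ring.
have G0 : G != 0 by apply: contraNneq q0 => E; rewrite EG E mul0r.
have ba : coprime_to b a.
  move=> x [y Ey]; apply: bdvd; exists y.
  by rewrite EG Ep; transitivity (G * (y * b)); [ring | rewrite -Ey; ring].
have pa : primitive a.
  by move=> x xa; apply: pp; rewrite Ep; apply: divides_mulr.
have [d0 e0] : d != 0 /\ e != 0.
  split; first by apply: contraNneq Q0 => E; rewrite EQ E mul0r.
  by apply: contraNneq P0 => E; rewrite EP E mul0r.
(* The contents of the two polynomials are reduced separately, in R; primitivity of [a] and [b] then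
   lets the two coprimality statements be combined. *)
have [g [e' [d' [Ee Ed de]]]] := ltR e d0.
have e'0 : e' != 0 by apply: contraNneq e0 => E; rewrite Ee E mulr0.
exists (g%:P * G), (e'%:P * a), (d'%:P * b); split.
- by rewrite EP Ep Ee polyCM; ring.
- by rewrite EQ EG Ed polyCM; ring.
move=> x [y Ey].
have [z Ez] : divides b (e'%:P * x).
  by apply: ba; exists (y * d'%:P); rewrite mulrA (mulrC a) Ey; ring.
have [z' Ez'] : divides e'%:P z.
  apply: (primitive_cancel ltR pb); exists x.
  by rewrite mulrC -Ez mulrC.
have e'P : e'%:P != 0 :> {poly R} by rewrite polyC_eq0.
have Ex : x = z' * b.
  by apply: (mulfI e'P); rewrite Ez Ez'; ring.
have [w Ew] : divides d'%:P z'.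
  have : divides d'%:P (a * (e'%:P * z')).
    exists y; apply: (mulIf bn0).
    by transitivity (e'%:P * a * x); [rewrite Ex; ring | rewrite Ey; ring].
  move=> /(primitive_cancel ltR pa) /divides_polyC dz.
  apply/divides_polyC => i; apply: de; have := dz i.
  by rewrite coefCM.
by exists w; rewrite Ex Ew; ring.
Qed.
End PolyLowestTerms.

(** * Polynomials in several variables *)

Lemma mpoly_ring_ind n (R : nzRingType) (P : {mpoly R[n]} -> Prop) :
    (forall c, P c%:MP) -> (forall i, P 'X_i) ->
    (forall p q, P p -> P q -> P (p + q)) ->
    (forall p q, P p -> P q -> P (p * q)) -> forall p, P p.
Proof.
move=> PC PX PD PM; elim/mpolyind => [|c m p _ _ IH].
  by rewrite -mpolyC0; exact: PC.
apply: (PD _ _ _ IH); rewrite -mul_mpolyC; apply: (PM) => //.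
rewrite mpolyXE_id; apply: big_ind => //; first by rewrite -mpolyC1.
move=> i _; elim: (m i) => [|k IHk]; first by rewrite expr0 -mpolyC1.
by rewrite exprS; apply: PM.
Qed.

Lemma mpoly_rmorph_eq n (R : nzRingType) (S : nzRingType)
    (f g : {rmorphism {mpoly R[n]} -> S}) :
    (forall c, f c%:MP = g c%:MP) -> (forall i, f 'X_i = g 'X_i) -> f =1 g.
Proof.
move=> fgC fgX; elim/mpoly_ring_ind => // p q fp fq.
  by rewrite !rmorphD fp fq.
by rewrite !rmorphM fp fq.
Qed.

Section MpolyStep.
Variables (R : comNzRingType) (n : nat).

(** The inverse of [muni]; the pair allows induction on the number of variables. *)
Definition multi_poly : {poly {mpoly R[n]}} -> {mpoly R[n.+1]} :=
  horner_eval ('X_ord_max) \o map_poly (@mwiden n R).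

HB.instance Definition _ := GRing.RMorphism.copy multi_poly
  (horner_eval ('X_ord_max) \o map_poly (@mwiden n R)).

Lemma muni_max : muni ('X_ord_max : {mpoly R[n.+1]}) = 'X.
Proof.
rewrite muniE msuppX big_seq1 mcoeffX eqxx scale1r mnm1E eqxx expr1.
rewrite (_ : [multinom _ | _ < _] = 0%MM) ?mpolyX0 ?scale1r //.
apply/mnmP => i; rewrite mnmE mnm1E mnm0E.
by rewrite -val_eqE /= gtn_eqF.
Qed.

Lemma muni_widen (i : 'I_n) :
  muni ('X_(widen_ord (leqnSn n) i) : {mpoly R[n.+1]}) = ('X_i)%:P.
Proof.
rewrite muniE msuppX big_seq1 mcoeffX eqxx scale1r mnm1E.
rewrite -val_eqE /= ltn_eqF // expr0 alg_polyC.
by congr (('X_[_])%:P); apply/mnmP => j; rewrite mnmE !mnm1E -!val_eqE.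
Qed.

Lemma ord_widen_max (i : 'I_n.+1) :
  i = ord_max \/ exists j, i = widen_ord (leqnSn n) j.
Proof.
have [ltin|] := ltnP i n; last first.
  move=> nlei; left; apply/val_inj/eqP => /=.
  by rewrite eqn_leq nlei -ltnS ltn_ord.
by right; exists (Ordinal ltin); apply: val_inj.
Qed.

Lemma multi_polyK : cancel (@muni n R) multi_poly.
Proof.
apply: (@mpoly_rmorph_eq _ _ _ (multi_poly \o @muni n R) idfun) => [c|i] /=.
  by rewrite muniC /multi_poly /= map_polyC /= mwidenC /horner_eval hornerC.
have [->|[j ->]] := ord_widen_max i.
  by rewrite muni_max /multi_poly /= map_polyX /horner_eval hornerX.
rewrite muni_widen /multi_poly /= map_polyC /= mwidenX mnmwiden1.
by rewrite /horner_eval hornerC.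
Qed.

Lemma muniK : cancel multi_poly (@muni n R).
Proof.
have widenK (p : {mpoly R[n]}) : muni (mwiden p) = p%:P.
  apply: (@mpoly_rmorph_eq _ _ _ (@muni n R \o @mwiden n R) polyC) => [c|i] /=.
    by rewrite mwidenC muniC.
  by rewrite mwidenX mnmwiden1 muni_widen.
elim/poly_ind => [|p c IH]; first by rewrite !raddf0.
rewrite 2!rmorphD 2!rmorphM /= IH /= /multi_poly /= map_polyX map_polyC.
rewrite /horner_eval hornerX hornerC.
by rewrite muni_max widenK.
Qed.

End MpolyStep.

Lemma lowest_terms_iso (R S : idomainType) (f : {rmorphism R -> S})
    (g : {rmorphism S -> R}) :
  cancel f g -> cancel g f -> has_lowest_terms S -> has_lowest_terms R.
Proof.
move=> fK gK ltS a b b0.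
have [|c [a' [b' [Ea Eb co]]]] := ltS (f a) (f b).
  by rewrite -(rmorph0 f) (can_eq fK).
exists (g c), (g a'), (g b'); split.
- by rewrite -rmorphM -Ea fK.
- by rewrite -rmorphM -Eb fK.
move=> x [y Ey]; have [|z Ez] := co (f x).
  by exists (f y); rewrite -[a']gK -[b']gK -!rmorphM Ey.
by exists (g z); rewrite -rmorphM -Ez fK.
Qed.

Lemma mpoly_lowest_terms (K : fieldType) n : has_lowest_terms {mpoly K[n]}.
Proof.
elim: n => [|n IH]; last first.
  exact: lowest_terms_iso (@multi_polyK K n) (@muniK K n) (poly_lowest_terms IH).
apply: (@lowest_terms_iso _ K (@mcoeff 0 K 0%MM) (@mpolyC 0 K)).
- move=> p; apply/mpolyP => m; rewrite mcoeffC.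
  have -> : m = 0%MM by apply/mnmP; case.
  by rewrite eqxx mulr1.
- by move=> c; rewrite /= mcoeffC eqxx mulr1.
move=> a b b0; exists b, (a / b), 1; split.
- by rewrite mulrC divfK.
- by rewrite mulr1.
by move=> x _; exists x; rewrite mulr1.
Qed.

(** By induction on the variables: at a point where the leading coefficient in the last variable is
    nonzero, one of the values 0, ..., [size q] - 1 of that variable is not a root, since
    characteristic 0 makes them distinct and they outnumber the roots. *)
Lemma mpoly_nonzero_point (K : numFieldType) n (p : {mpoly K[n]}) :
  p != 0 -> exists v, p.@[v] != 0.
Proof.
elim: n p => [|n IH] p p0.
  exists (fun _ => 0); apply: contra_neq p0 => E.
  suff Ep : p = (p@_0%MM)%:MP.
    by rewrite Ep; rewrite Ep mevalC in E; rewrite E mpolyC0.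
  apply/mpolyP => m; rewrite mcoeffC.
  have -> : m = 0%MM by apply/mnmP; case.
  by rewrite eqxx mulr1.
have m0 : muni p != 0.
  by apply: contraNneq p0 => E; rewrite -[p]multi_polyK E rmorph0.
have [v v0] : exists v, (lead_coef (muni p)).@[v] != 0.
  by apply: IH; rewrite lead_coef_eq0.
pose q := map_poly (meval v) (muni p).
have q0 : q != 0.
  apply: contraNneq v0 => /(congr1 (fun r : {poly K} => r`_(size (muni p)).-1)).
  by rewrite coef_map coef0 /= lead_coefE => ->.
have [x x0] : exists x, q.[x] != 0.
  apply: contrapT => /forallNP qx; have := @max_poly_roots _ q.
  move=> /(_ [seq i%:R | i <- iota 0 (size q)]) /(_ q0).
  rewrite size_map size_iota ltnn map_inj_uniq ?iota_uniq => [H|]; last first.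
    by move=> i j /eqP; rewrite eqr_nat => /eqP.
  suff: false by []; apply: H => //.
  by apply/allP => y _; apply: contrapT => /negP; exact: qx.
pose w (i : 'I_n.+1) : K := if insub (val i) is Some j then v j else x.
exists w; suff -> : p.@[w] = q.[x] by [].
apply: (@mpoly_rmorph_eq _ _ _ (meval w)
  (horner_eval x \o map_poly (meval v) \o @muni n K)) => [c|i] /=.
  by rewrite mevalC muniC map_polyC /= /horner_eval hornerC mevalC.
rewrite mevalXU; have [->|[j ->]] := ord_widen_max i.
  rewrite muni_max map_polyX /horner_eval hornerX /w insubF //=.
  exact: ltnn.
rewrite muni_widen map_polyC /horner_eval hornerC /= mevalXU /w.
by case: insubP => /= [k _ /val_inj ->|]; rewrite ?ltn_ord.
Qed.

(** * Derivations *)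

(** Linearity over a base ring is not asked for, so that vector fields, [deriv] and derivations
    acting on coefficients are all covered. *)
Definition derivation_along (A B : comNzRingType) (phi d : A -> B) :=
  (forall p q, d (p + q) = d p + d q) /\
  (forall p q, d (p * q) = d p * phi q + phi p * d q).

Lemma derivation0 (A B : comNzRingType) (phi d : A -> B) :
  derivation_along phi d -> d 0 = 0.
Proof. by case=> dD _; apply: (addrI (d 0)); rewrite -dD !addr0. Qed.

Section Derivations.
Variables A B : comNzRingType.

Lemma derivation_sum n (q : 'I_n -> {mpoly A[n]}) :
  derivation_along id (fun p => \sum_(i < n) q i * p^`M(i)).
Proof.
have dD (p r : {mpoly A[n]}) : \sum_(i < n) q i * (p + r)^`M(i) =
    \sum_(i < n) q i * p^`M(i) + \sum_(i < n) q i * r^`M(i).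
  by rewrite -big_split /=; apply: eq_bigr => i _; rewrite mderivD mulrDr.
have dM (p r : {mpoly A[n]}) : \sum_(i < n) q i * (p * r)^`M(i) =
    (\sum_(i < n) q i * p^`M(i)) * r + p * \sum_(i < n) q i * r^`M(i).
  rewrite mulr_suml mulr_sumr -big_split /=; apply: eq_bigr => i _.
  by rewrite mderivM; ring.
by split.
Qed.

Lemma derivation_deriv : derivation_along id (@deriv A).
Proof. by split=> p q; rewrite ?derivD ?derivM. Qed.

Lemma derivation_map_poly (d : A -> A) :
  derivation_along id d -> derivation_along id (map_poly d).
Proof.
move=> dd; have d0 := derivation0 dd; have [dD dM] := dd.
split=> p q; apply/polyP => i.
  by rewrite !(coefD, coef_map_id0) // dD.
rewrite coefD coef_map_id0 // !coefM (big_morph d dD d0).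
have E j : d (p`_j * q`_(i - j)) =
    (map_poly d p)`_j * q`_(i - j) + p`_j * (map_poly d q)`_(i - j).
  by rewrite dM !coef_map_id0.
by apply: etrans (big_split _ _ _ _ _); apply: eq_bigr => j _; exact: E.
Qed.

Lemma derivationD (phi d1 d2 : A -> B) :
  derivation_along phi d1 -> derivation_along phi d2 ->
  derivation_along phi (fun p => d1 p + d2 p).
Proof.
by move=> [D1 M1] [D2 M2]; split=> p q; rewrite ?D1 ?D2 ?M1 ?M2; ring.
Qed.

Lemma derivationMl (phi d : A -> B) c :
  derivation_along phi d -> derivation_along phi (fun p => c * d p).
Proof. by move=> [D1 M1]; split=> p q; rewrite ?D1 ?M1; ring. Qed.

End Derivations.

Lemma mderivXU n (A : nzRingType) (i j : 'I_n) :
  ('X_j : {mpoly A[n]})^`M(i) = (i == j)%:R.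
Proof.
rewrite mderivX mnm1E eq_sym; case: eqP => [->|_]; last by rewrite scale0r.
rewrite scale1r (_ : _ - _ = 0)%MM ?mpolyX0 //.
by apply/mnmP => k; rewrite mnmBE subnn mnm0E.
Qed.

Lemma derivation_sumX n (A : comNzRingType) (q : 'I_n -> {mpoly A[n]}) j :
  \sum_(i < n) q i * ('X_j : {mpoly A[n]})^`M(i) = q j.
Proof.
rewrite (bigD1 j) //= mderivXU eqxx mulr1 big1 ?addr0 // => i /negPf ij.
by rewrite mderivXU ij mulr0.
Qed.

Lemma mcoeffXM n (A : nzRingType) (p : {mpoly A[n]}) j (m : 'X_{1..n}) :
  ('X_j * p)@_m = if (0 < m j)%N then p@_(m - U_(j)) else 0.
Proof.
rewrite -commr_mpolyX; case: ifP => [mj|].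
  have le_m : (U_(j) <= m)%MM by rewrite lep1mP -lt0n.
  by rewrite -{1}(submK le_m) addmC mcoeffMX.
move=> /negbT; rewrite -eqn0Ngt => /eqP mj.
elim/mpolyind: p => [|c m' p _ _ IH]; first by rewrite mul0r mcoeff0.
rewrite mulrDl mcoeffD IH addr0 -scalerAl mcoeffZ -mpolyXD mcoeffX.
case: eqP => [E|_]; last by rewrite mulr0.
by move: mj; rewrite -E mnmDE mnm1E eqxx addn1.
Qed.

Lemma mcoeff_XM_deriv n (A : nzRingType) (p : {mpoly A[n]}) i (m : 'X_{1..n}) :
  ('X_i * p^`M(i))@_m = p@_m *+ m i.
Proof.
rewrite mcoeffXM; case: ifP => [mi|]; last first.
  by move=> /negbT; rewrite -eqn0Ngt => /eqP ->.
rewrite mcoeff_deriv submK; last by rewrite lep1mP -lt0n.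
by rewrite mnmBE mnm1E eqxx subn1 prednK.
Qed.

(** * The Airy equations at infinity *)

Definition vfield n (A : nzRingType) (q : 'I_n -> {mpoly A[n]}) p :=
  \sum_(i < n) q i * p^`M(i).

Local Notation o0 := (@Ordinal 4 0 isT).
Local Notation o1 := (@Ordinal 4 1 isT).
Local Notation o2 := (@Ordinal 4 2 isT).
Local Notation o3 := (@Ordinal 4 3 isT).

(* The variables [u_+], [u_-], [v_+], [v_-] have indices 0, 1, 2, 3. *)
Definition partner (i : 'I_4) : 'I_4 := nth o0 [:: o1; o0; o3; o2] i.

Lemma ord4P (P : 'I_4 -> Prop) : P o0 -> P o1 -> P o2 -> P o3 -> forall i, P i.
Proof.
move=> P0 P1 P2 P3 [[|[|[|[|//]]]] lti];
  [move: P0 | move: P1 | move: P2 | move: P3]; congr P; exact: val_inj.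
Qed.

Lemma big_ord4 (T : Type) (idx : T) (op : Monoid.law idx) (F : 'I_4 -> T) :
  \big[op/idx]_(i < 4) F i = op (op (op (F o0) (F o1)) (F o2)) (F o3).
Proof.
rewrite !big_ord_recl big_ord0 Monoid.mulm1 !Monoid.mulmA.
by congr (op (op (op (F _) (F _)) (F _)) (F _)); apply: val_inj.
Qed.

Lemma partner_neq i : partner i != i. Proof. by elim/ord4P: i. Qed.

(** The resonant monomials: products of powers of u_+ u_- and v_+ v_-. *)
Definition balanced (m : 'X_{1..4}) := [forall i, m (partner i) == m i].

Lemma balancedP (m : 'X_{1..4}) : reflect (m o1 = m o0 /\ m o3 = m o2) (balanced m).
Proof.
apply: (iffP forallP) => [bm|[m1 m3]].
  by split; apply/eqP; [exact: (bm o0)|exact: (bm o2)].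
by elim/ord4P; rewrite /partner /= ?m1 ?m3 eqxx.
Qed.

Section AirySub.
Variable K : numFieldType.
Local Notation W := {mpoly {poly K}[4]}.
Implicit Types p : W.

(* For [u'' = mu^2 t u], [t = s^2], [u = u_+ - u_-], [u' = mu s (u_+ + u_-)] one
   gets [4 s^2 u_+-' = +- 4 mu s^3 u_+- - (u_+ + u_-)]; the two terms are
   [airy_main] and [airy_sub]. *)
Definition airy_sub i : W := 'X_i + 'X_(partner i).

(** The diagonal terms form the Euler operator, which multiplies by the degree. An off-diagonal term
    turns one factor of a balanced monomial into its partner, and the result is no longer
    balanced. *)
Lemma mcoeff_airy_sub_balanced p m :
    (forall m', m' \in msupp p -> balanced m') -> balanced m ->
  (vfield airy_sub p)@_m = p@_m *+ mdeg m.
Proof.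
move=> bp bm; rewrite /vfield raddf_sum mdegE -sumrMnr; apply: eq_bigr => i _.
rewrite mulrDl /= mcoeffD mcoeff_XM_deriv mcoeffXM; case: ifP => [mi|]; last first.
  by rewrite addr0.
rewrite mcoeff_deriv [X in X *+ (_).+1]memN_msupp_eq0 ?mul0rn ?addr0 //.
apply/negP => /bp /forallP/(_ i).
rewrite !mnmDE !mnmBE !mnm1E eqxx [i == partner i]eq_sym (negPf (partner_neq i)).
rewrite (eqP (forallP bm i)) => /eqP.
by move: mi; rewrite (eqP (forallP bm i)); case: (m i) => // k _; lia.
Qed.

End AirySub.

Section Balanced.
Variables (K : numFieldType) (mu1 mu2 : K).
Hypotheses (mu1_gt : 0 < mu1 ^+ 2) (mu2_lt : mu2 ^+ 2 < 0).
Local Notation W := {mpoly {poly K}[4]}.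
Implicit Types p : W.

Definition airy_weight (i : 'I_4) : K := nth 0 [:: mu1; - mu1; mu2; - mu2] i.

Definition airy_main i : W := (airy_weight i)%:P%:MP * 'X_i.

Lemma mcoeff_airy_main p m :
  (vfield airy_main p)@_m = (\sum_(i < 4) airy_weight i *+ m i)%:P * p@_m.
Proof.
rewrite /vfield raddf_sum rmorph_sum mulr_suml; apply: eq_bigr => i _.
rewrite /airy_main -mulrA /= mcoeffCM mcoeff_XM_deriv polyCMn.
by rewrite mulrnAr mulrnAl.
Qed.

(* The weights [mu1] and [mu2] are independent over the rationals, because one
   is real and the other purely imaginary. *)
Lemma airy_weight_eq0 (m : 'X_{1..4}) :
  (\sum_(i < 4) airy_weight i *+ m i == 0) = balanced m.
Proof.
rewrite big_ord4 /= /airy_weight /=.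
pose a : K := (m o0)%:R - (m o1)%:R; pose b : K := (m o2)%:R - (m o3)%:R.
have -> : mu1 *+ m o0 + - mu1 *+ m o1 + mu2 *+ m o2 + - mu2 *+ m o3 =
    mu1 * a + mu2 * b.
  rewrite -(mulr_natr mu1) -(mulr_natr (- mu1)) -(mulr_natr mu2).
  by rewrite -(mulr_natr (- mu2)) /a /b; ring.
have sub0 i j : ((m i)%:R - (m j)%:R == 0 :> K) = (m j == m i).
  by rewrite subr_eq0 eqr_nat eq_sym.
apply/eqP/balancedP => [E|[E1 E3]]; last first.
  by rewrite /a /b E1 E3 !subrr !mulr0 addr0.
have sq_ge0 i j : 0 <= ((m i)%:R - (m j)%:R : K) ^+ 2.
  by rewrite real_exprn_even_ge0 // rpredB ?realn.
have {}E : mu1 ^+ 2 * a ^+ 2 = mu2 ^+ 2 * b ^+ 2.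
  by rewrite -!exprMn -(addr0_eq E) sqrrN.
have /eqP a2 : a ^+ 2 == 0.
  rewrite eq_le sq_ge0 andbT -(pmulr_rle0 _ mu1_gt) E nmulr_rle0 //.
  exact: sq_ge0.
have a0 : a = 0 by move/eqP: a2; rewrite expf_eq0 => /eqP.
have b0 : b = 0.
  move/eqP: E; rewrite a0 expr0n mulr0 eq_sym mulf_eq0 (lt_eqF mu2_lt) /=.
  by rewrite expf_eq0 => /eqP.
by split; apply/eqP; rewrite -sub0; apply/eqP.
Qed.

Lemma airy_main_eq0 p :
  vfield airy_main p = 0 -> forall m, m \in msupp p -> balanced m.
Proof.
move=> Ep m; rewrite mcoeff_msupp -airy_weight_eq0; apply: contraNT => wm.
have /eqP := mcoeff_airy_main p m.
by rewrite Ep mcoeff0 eq_sym mulf_eq0 polyC_eq0 (negPf wm).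
Qed.

Lemma mcoeff_airy_main_balanced p m :
  balanced m -> (vfield airy_main p)@_m = 0.
Proof.
by rewrite -airy_weight_eq0 mcoeff_airy_main => /eqP ->; rewrite mul0r.
Qed.

End Balanced.

Lemma poly_mulrn_eq0 (K : numFieldType) (p : {poly K}) k :
  (p *+ k == 0) = (k == 0)%N || (p == 0).
Proof. by rewrite -scaler_nat scaler_eq0 pnatr_eq0. Qed.

Section Lead.
Variables (K : numFieldType) (mu1 mu2 : K).
Hypotheses (mu1_gt : 0 < mu1 ^+ 2) (mu2_lt : mu2 ^+ 2 < 0).
Local Notation W := {mpoly {poly K}[4]}.
Implicit Types p : W.
Local Notation E := (vfield (airy_main mu1 mu2)).
Local Notation N := (vfield (@airy_sub K)).

Lemma mpoly_mulrn_eq0 p k : (p *+ k == 0) = (k == 0)%N || (p == 0).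
Proof.
have [->|k0] := eqVneq k 0%N; first by rewrite mulr0n eqxx.
apply/eqP/eqP => [pk|->]; last by rewrite mul0rn.
apply/mpolyP => m; apply/eqP; have /eqP := congr1 (mcoeff m) pk.
by rewrite mcoeffMn !mcoeff0 poly_mulrn_eq0 (negPf k0).
Qed.

Lemma vfield0 (q : 'I_4 -> W) : vfield q 0 = 0.
Proof. by rewrite /vfield big1 // => i _; rewrite mderiv0 mulr0. Qed.

(* [a] is the lowest part of a Darboux polynomial and [4 s^2 r] its cofactor.
   At top order [s^(n+3)] the leading coefficient is killed by the diagonal [E],
   hence balanced; at [s^(n+2)] balanced monomials give [r = 0], and at [s^n]
   they give [2 n = mdeg m], because [E a_(n-3)] has no balanced monomial and
   the off-diagonal terms of [N] destroy balance. *)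
Lemma airy_lead (a r : {poly W}) :
    a != 0 -> (forall n, odd n -> r`_n = 0) ->
    (forall n, exists c, r`_n = c%:MP) ->
    ('X^3 * map_poly E a) *+ 4 + ('X * a^`()) *+ 2 - map_poly N a =
      ('X^2 * (r * a)) *+ 4 ->
  forall m, m \in msupp (lead_coef a) ->
    balanced m /\ mdeg m = ((size a).-1 * 2)%N.
Proof.
move=> a0 r_odd r_const eq_a; set n := (size a).-1.
have sz_a : size a = n.+1 by rewrite /n prednK // size_poly_gt0.
have lead0 : lead_coef a != 0 by rewrite lead_coef_eq0.
have gt_a j : (n < j)%N -> a`_j = 0 by move=> ltj; rewrite nth_default // sz_a.
have eq_j j : (if (j < 3)%N then 0 else E a`_(j - 3)) *+ 4 + a`_j *+ (j * 2) -
    N a`_j = (if (j < 2)%N then 0 else (r * a)`_(j - 2)) *+ 4.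
  have := congr1 (fun p : {poly W} => p`_j) eq_a.
  rewrite coefB coefD !coefMn !coefXnM coefXM coef_deriv.
  rewrite !coef_map_id0 ?vfield0 // => <-; rewrite mulrnA.
  by case: j => [|j] //=; rewrite mulr0n.
(* As [r] is even in s, a nonconstant [r] has degree at least 2, and the right side then has degree
   at least n + 4, beyond the n + 3 that the left side can reach. *)
have r_le0 : (size r <= 1)%N.
  rewrite leqNgt; apply/negP => gt1; set d := (size r).-1.
  have d_gt0 : (0 < d)%N by rewrite /d; case: (size r) gt1 => [|[]].
  have d_odd : ~~ odd d.
    have r0 : r != 0 by rewrite -size_poly_gt0 (leq_trans _ gt1).
    by apply: contraTN r0 => /r_odd; rewrite -lead_coefE => /eqP;
      rewrite lead_coef_eq0 => ->.
  have d_gt1 : (1 < d)%N by case: (d) d_gt0 d_odd => [|[]].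
  have := eq_j (d + n + 2)%N.
  rewrite !gt_a ?vfield0; [|lia|lia]; rewrite ifN; last lia.
  rewrite addnK !mul0rn !add0r oppr0 ifN; last lia.
  have -> : (d + n)%N = (size (r * a)).-1.
    have r0 : r != 0 by rewrite -size_poly_gt0 (leq_trans _ gt1).
    by rewrite size_mul // sz_a addnS /=; rewrite /d; case: (size r) gt1.
  move/esym/eqP; rewrite -lead_coefE lead_coefM mpoly_mulrn_eq0 /= mulf_eq0.
  by rewrite (negPf lead0) orbF lead_coef_eq0 -size_poly_eq0; case: (size r) gt1.
have [c Er] : exists c, r = c%:MP%:P.
  have [c Ec] := r_const 0%N; exists c.
  by rewrite [LHS]size1_polyC // Ec.
have E_lead : E (lead_coef a) = 0.
  have a3 : a`_n.+3 = 0 by apply: gt_a; lia.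
  have := eq_j n.+3; rewrite a3 mul0rn vfield0 subr0 addr0.
  rewrite !ltnS ltn0 !subSS !subn0 Er coefCM (gt_a n.+1) // mulr0 mul0rn => /eqP.
  by rewrite mpoly_mulrn_eq0 => /eqP.
have bal := airy_main_eq0 mu1_gt mu2_lt E_lead.
have coefE j m : balanced m -> (if (j < 3)%N then 0 else E a`_(j - 3))@_m = 0.
  by move=> bm; case: ifP => _; rewrite ?mcoeff0 ?mcoeff_airy_main_balanced.
have c0 : c = 0.
  have [m m_in] : exists m, m \in msupp (lead_coef a).
    by exists (mlead (lead_coef a)); exact: mlead_supp.
  have a2 : a`_n.+2 = 0 by apply: gt_a; lia.
  have := congr1 (mcoeff m) (eq_j n.+2).
  rewrite a2 mul0rn vfield0 subr0 addr0 Er coefCM subn2 /=.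
  rewrite !mcoeffMn coefE ?bal // mul0rn mcoeffCM => /esym/eqP.
  rewrite poly_mulrn_eq0 /= mulf_eq0 => /orP[/eqP //|].
  by rewrite -lead_coefE mcoeff_eq0 m_in.
move=> m m_in; split; first exact: bal.
have := congr1 (mcoeff m) (eq_j n).
rewrite Er c0 mpolyC0 polyC0 mul0r coef0 if_same mul0rn mcoeff0 -lead_coefE.
rewrite mcoeffB mcoeffD !mcoeffMn coefE ?bal // mul0rn add0r.
rewrite mcoeff_airy_sub_balanced ?bal // => /eqP; rewrite subr_eq0 => /eqP.
have := mcoeff_msupp (lead_coef a) m; rewrite m_in => /esym nz.
case: (ltngtP (mdeg m) (n * 2)%N) => // lt /eqP.
  by rewrite -subr_eq0 -mulrnBr ?(ltnW lt) // poly_mulrn_eq0 (negPf nz) orbF; lia.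
rewrite eq_sym -subr_eq0 -mulrnBr ?(ltnW lt) // poly_mulrn_eq0 (negPf nz) orbF.
by lia.
Qed.

End Lead.

Section FoldPM.
Variable K : numFieldType.
Local Notation W := {mpoly {poly K}[4]}.
Implicit Types p : W.

(* Restriction to [u_+ = u_- = 1], [v_+ = v_- = 'X], where [u = v = 0]. *)
Definition fold_pm : W -> {poly {poly K}} :=
  mmap polyC (fun i : 'I_4 => if (i < 2)%N then 1 else 'X).

HB.instance Definition _ := GRing.RMorphism.copy fold_pm
  (mmap polyC (fun i : 'I_4 => if (i < 2)%N then 1 else 'X)).

(** A balanced monomial of degree n is determined by its degree in v_+, v_-, which is the power of
    ['X] that it becomes; distinct monomials therefore cannot cancel. *)
Lemma fold_pm_neq0 p n : p != 0 ->
  (forall m, m \in msupp p -> balanced m /\ mdeg m = n) -> fold_pm p != 0.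
Proof.
move=> p0 bal; set m0 := mlead p.
have m0_in : m0 \in msupp p by exact: mlead_supp.
apply/eqP => /(congr1 (fun q : {poly {poly K}} => q`_(m0 o2 + m0 o3))).
rewrite coef0 /fold_pm /mmap coef_sum (bigD1_seq m0) ?msupp_uniq //=.
have coefM m k : ((p@_m)%:P *
    mmap1 (fun i : 'I_4 => if (i < 2)%N then 1 else 'X) m)`_k =
    p@_m * (k == m o2 + m o3)%N%:R.
  by rewrite /mmap1 big_ord4 /= !expr1n !mul1r -exprD coefCM coefXn.
rewrite coefM eqxx mulr1 big_seq_cond big1 ?addr0 => [E0|m].
  by have := mcoeff_msupp p m0; rewrite E0 eqxx m0_in.
case/andP => m_in m_neq; rewrite coefM; case: eqP => [E0|]; rewrite ?mulr0 //.
have [/balancedP[b1 b3] dm] := bal m m_in.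
have [/balancedP[c1 c3] dm0] := bal m0 m0_in.
case/eqP: m_neq; apply/mnmP; move: dm dm0; rewrite !mdegE !big_ord4 /= => dm dm0.
by elim/ord4P; lia.
Qed.
End FoldPM.

Section VfieldTheory.
Variables (n : nat) (A : comNzRingType) (q : 'I_n -> {mpoly A[n]}).
Implicit Types p : {mpoly A[n]}.

Lemma vfieldX i : vfield q 'X_i = q i.
Proof. exact: derivation_sumX. Qed.

Lemma vfieldD p1 p2 : vfield q (p1 + p2) = vfield q p1 + vfield q p2.
Proof. exact: (derivation_sum q).1. Qed.

Lemma vfieldCM c p : vfield q (c%:MP * p) = c%:MP * vfield q p.
Proof.
rewrite /vfield mulr_sumr; apply: eq_bigr => i _.
by rewrite mderiv_mulC mulrCA.
Qed.

Lemma vfieldN p : vfield q (- p) = - vfield q p.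
Proof. by rewrite -mulN1r -[RHS]mulN1r -mpolyC1 -mpolyCN vfieldCM. Qed.

Lemma vfieldMn p k : vfield q (p *+ k) = vfield q p *+ k.
Proof.
rewrite /vfield -sumrMnl; apply: eq_bigr => i _.
by rewrite mderivMn mulrnAr.
Qed.

Definition vfieldE := (vfieldX, vfieldD, vfieldN, vfieldCM, vfieldMn).

End VfieldTheory.

(** The inverse of the linear change of coordinates from u, v and their derivatives divided by s to
    the four variations, with [r] = rho and [h] = 1/2. It serves both to transport the nonlinear
    terms and to lift points to the chart. *)
Fact airy_quad_aux (B : comPzRingType) (r h en zn xn on : B)
    (u := r * h * (zn + (3 + 5 * r) * h * en)) (v := h * en - u)
    (w := r * h * (xn - on - (3 + 5 * r) * h * (xn *+ 4 + on)))
    (z := - (h * (xn *+ 4 + on)) - w) :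
    5 * (r * r) = 1 -> 2 * h = 1 ->
  [/\ u *+ 2 + v *+ 2 = en, (r * (u - v)) *+ 5 - (u + v) *+ 3 = zn,
      r * (w - z) - (w + z) = xn & (w + z) *+ 2 - (r * (w - z)) *+ 4 = on].
Proof.
move=> Hr Hh; have Hrh : 10 * (r * r) * h = 1.
  by transitivity (5 * (r * r) * (2 * h)); [ring | rewrite Hr Hh mulr1].
(* In this ring 5 is invertible, with inverse [r * r]. *)
have mul5I (a b : B) : 5 * a = 5 * b -> a = b.
  have K5 c : c = r * r * (5 * c) by rewrite mulrA (mulrC _ 5) Hr mul1r.
  by move=> E; rewrite (K5 a) (K5 b) E.
rewrite /v /z /u /w {u v w z}.
split; [| |apply: mul5I|apply: mul5I]; apply: subr0_eq.
- by transitivity ((2 * h - 1) * en); [ring | rewrite Hh subrr mul0r].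
- transitivity ((10 * (r * r) * h - 1) * (zn + h * (3 + 5 * r) * en)); first ring.
  by rewrite Hrh subrr mul0r.
- transitivity ((10 * (r * r) * h - 1) *
    (xn - on - (3 + 5 * r) * h * (4 * xn + on)) + (2 * h - 1) * (4 * xn + on)).
    by ring.
  by rewrite Hrh Hh !subrr !mul0r addr0.
- transitivity ((10 * (r * r) * h - 1) *
    (- 4 * (xn - on - (3 + 5 * r) * h * (4 * xn + on)))
    + (2 * h - 1) * ((4 * xn + on))); first ring.
  by rewrite Hrh Hh !subrr !mul0r addr0.
Qed.

(** * The Sasano system near its rational solution *)

Section AiryForms.
Variables (K : numFieldType) (rho mu1 mu2 : K).
Hypotheses (rho2 : 5 * rho ^+ 2 = 1)
  (mu1_gt : 0 < mu1 ^+ 2) (mu2_lt : mu2 ^+ 2 < 0)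
  (mu1E : mu1 ^+ 2 = 2 + 6 * rho) (mu2E : mu2 ^+ 2 = 2 - 6 * rho).
Local Notation W := {mpoly {poly K}[4]}.

Local Notation cst c := (c%:P%:MP : W).
Local Notation cr := (cst rho).
Local Notation half := (cst 2^-1).

(** For the linear equations, [u0] and [v0] are the Airy functions u and v; [u1] and [v1] below are
    u'/s and v'/s. *)
Definition u0 : W := 'X_o0 - 'X_o1.
Definition v0 : W := 'X_o2 - 'X_o3.
Definition u1 : W := cst mu1 * ('X_o0 + 'X_o1).
Definition v1 : W := cst mu2 * ('X_o2 + 'X_o3).

(* The variations of [y], [z], [x] and [w], the last two divided by [s], in the
   coordinates that decouple the variational equations. *)
Definition eta : W := u0 *+ 2 + v0 *+ 2.
Definition zeta : W := (cr * (u0 - v0)) *+ 5 - (u0 + v0) *+ 3.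
Definition xi : W := cr * (u1 - v1) - (u1 + v1).
Definition omega : W := (u1 + v1) *+ 2 - (cr * (u1 - v1)) *+ 4.

(* The quadratic parts of the vector field. *)
Definition eta_nl : W := - (eta ^+ 2 *+ 2).
Definition zeta_nl : W := zeta ^+ 2 + (eta * zeta) *+ 2.
Definition xi_nl : W := (xi * eta) *+ 4 + (zeta * omega) *+ 2.
Definition omega_nl : W := - ((zeta * omega) *+ 2) - (eta * omega) *+ 2.

Definition u0_nl : W :=
  cr * half * (zeta_nl + (3 + 5 * cr) * half * eta_nl).
Definition v0_nl : W := half * eta_nl - u0_nl.
Definition u1_nl : W := cr * half *
  (xi_nl - omega_nl - (3 + 5 * cr) * half * (xi_nl *+ 4 + omega_nl)).
Definition v1_nl : W := - (half * (xi_nl *+ 4 + omega_nl)) - u1_nl.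

(** Obtained from u_+- = (u1 / mu1 +- u0) / 2, and likewise for v. *)
Definition airy_quad (i : 'I_4) : W := nth 0
  [:: half * (cst mu1^-1 * u1_nl + u0_nl);
      half * (cst mu1^-1 * u1_nl - u0_nl);
      half * (cst mu2^-1 * v1_nl + v0_nl);
      half * (cst mu2^-1 * v1_nl - v0_nl)] i.

Local Notation E := (vfield (airy_main mu1 mu2)).
Local Notation N := (vfield (@airy_sub K)).
Local Notation G := (vfield airy_quad).

Lemma cst_rho2 : 5 * (cr * cr) = 1.
Proof.
have := congr1 (fun c => cst c) rho2.
by rewrite polyCM mpolyCM expr2 polyCM mpolyCM polyC_natr mpolyC_nat.
Qed.

Lemma cst_mu1 : cst mu1 * cst mu1 = 2 + 6 * cr.
Proof.
have := congr1 (fun c => cst c) mu1E.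
rewrite polyCD mpolyCD expr2 !polyCM !mpolyCM.
by rewrite !polyC_natr !mpolyC_nat.
Qed.

Lemma cst_mu2 : cst mu2 * cst mu2 = 2 - 6 * cr.
Proof.
have := congr1 (fun c => cst c) mu2E.
rewrite polyCB mpolyCB expr2 !polyCM !mpolyCM.
by rewrite !polyC_natr !mpolyC_nat.
Qed.

Lemma cst_half : 2 * half = 1.
Proof.
have two_neq0 : 2 != 0 :> K by rewrite pnatr_eq0.
have := congr1 (fun c => cst c) (mulfV two_neq0).
by rewrite polyCM mpolyCM polyC_natr mpolyC_nat.
Qed.

Lemma cst_mu1V : cst mu1 * cst mu1^-1 = 1.
Proof.
rewrite -mpolyCM -polyCM mulfV //; apply: contraTneq mu1_gt => ->.
by rewrite expr0n ltxx.
Qed.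

Lemma cst_mu2V : cst mu2 * cst mu2^-1 = 1.
Proof.
rewrite -mpolyCM -polyCM mulfV //; apply: contraTneq mu2_lt => ->.
by rewrite expr0n ltxx.
Qed.

(** [airy_sub] kills the differences u_+ - u_-, v_+ - v_- and doubles the sums. The doubling comes
    from dividing x and w by s, as 4 s^2 d/dt multiplies 1/s by -2. *)
Lemma airy_sub_form : [/\ N eta = 0, N zeta = 0, N xi = xi *+ 2
  & N omega = omega *+ 2].
Proof.
rewrite /eta /zeta /xi /omega /u0 /v0 /u1 /v1 !vfieldE /airy_sub /partner /=.
by split; ring.
Qed.

(** These are the variational equations along x = w = -2t/5, after the powers of s are scaled
    out. *)
Lemma airy_main_form :
  [/\ E eta = - (xi *+ 4) - omega, E zeta = xi - omega,
      5 * E xi = - (eta *+ 8) - zeta *+ 4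
    & 5 * E omega = (eta + zeta) *+ 4].
Proof.
have := (cst_rho2, cst_mu1, cst_mu2) => -[[]].
rewrite /eta /zeta /xi /omega /u0 /v0 /u1 /v1 !vfieldE /airy_main.
rewrite /airy_weight /= !polyCN !mpolyCN.
move: cr (cst mu1) (cst mu2) => r m1 m2 Hr Hm1 Hm2.
split; [ring|ring|apply: subr0_eq|apply: subr0_eq].
(* An explicit combination of the relations [Hm1], [Hm2] and [Hr]. *)
- transitivity
    ((m1 * m1 - (2 + 6 * r)) * (5 * (r - 1) * ('X_o0 - 'X_o1))
     - (m2 * m2 - (2 - 6 * r)) * (5 * (r + 1) * ('X_o2 - 'X_o3))
     + (5 * (r * r) - 1) * (6 * ('X_o0 - 'X_o1) + 6 * ('X_o2 - 'X_o3))); first ring.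
  by rewrite Hr Hm1 Hm2 !subrr !(mul0r, oppr0, addr0).
- transitivity
    ((m1 * m1 - (2 + 6 * r)) * (5 * (2 - 4 * r) * ('X_o0 - 'X_o1))
     + (m2 * m2 - (2 - 6 * r)) * (5 * (2 + 4 * r) * ('X_o2 - 'X_o3))
     - (5 * (r * r) - 1) * (24 * ('X_o0 - 'X_o1) + 24 * ('X_o2 - 'X_o3))); first ring.
  by rewrite Hr Hm1 Hm2 !subrr !(mul0r, oppr0, addr0).
Qed.

Lemma airy_quad_uv :
  [/\ G u0 = u0_nl, G v0 = v0_nl, G u1 = u1_nl & G v1 = v1_nl].
Proof.
have := (cst_half, cst_mu1V, cst_mu2V) => -[[]].
rewrite /u0 /v0 /u1 /v1 !vfieldE /airy_quad /=.
move: half (cst mu1) (cst mu2) (cst mu1^-1) (cst mu2^-1) => h m1 m2 n1 n2.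
move: u0_nl v0_nl u1_nl v1_nl => un vn wn zn Hh Hm1 Hm2.
split; apply: subr0_eq.
- by transitivity ((2 * h - 1) * un); [ring | rewrite Hh subrr mul0r].
- by transitivity ((2 * h - 1) * vn); [ring | rewrite Hh subrr mul0r].
- transitivity ((2 * h - 1) * wn + (m1 * n1 - 1) * (2 * h * wn)); first ring.
  by rewrite Hh Hm1 !subrr !mul0r addr0.
- transitivity ((2 * h - 1) * zn + (m2 * n2 - 1) * (2 * h * zn)); first ring.
  by rewrite Hh Hm2 !subrr !mul0r addr0.
Qed.

Lemma airy_quad_form :
  [/\ G eta = eta_nl, G zeta = zeta_nl, G xi = xi_nl & G omega = omega_nl].
Proof.
have := airy_quad_uv; rewrite /eta /zeta /xi /omega.
move: u0 v0 u1 v1 => a b c d [Ga Gb Gc Gd]; rewrite !vfieldE Ga Gb Gc Gd.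
exact: airy_quad_aux cst_rho2 cst_half.
Qed.

End AiryForms.

Lemma derivation1 (A : comNzRingType) (d : A -> A) :
  derivation_along id d -> d 1 = 0.
Proof.
case=> _ dM; apply: (addrI (d 1)); rewrite addr0.
by rewrite -{3}[1]mulr1 dM mulr1 mul1r.
Qed.

Lemma derivationN (A : comNzRingType) (d : A -> A) p :
  derivation_along id d -> d (- p) = - d p.
Proof.
by move=> dd; apply: (addrI (d p)); rewrite -dd.1 !subrr (derivation0 dd).
Qed.

Lemma derivation_mapC (A : comNzRingType) (d : A -> A) c :
  derivation_along id d -> map_poly d c%:P = (d c)%:P.
Proof.
move=> dd; apply/polyP => i; rewrite coef_map_id0 ?(derivation0 dd) //.
by rewrite !coefC; case: eqP; rewrite ?(derivation0 dd).
Qed.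

Lemma derivation_mapX (A : comNzRingType) (d : A -> A) :
  derivation_along id d -> map_poly d 'X = 0.
Proof.
move=> dd; apply/polyP => i; rewrite coef_map_id0 ?(derivation0 dd) //.
by rewrite coefX coef0; case: eqP => _; rewrite ?(derivation0 dd) ?(derivation1 dd).
Qed.

Lemma hamiltonian_energy (K : numFieldType) n (H : {mpoly K[n + n]}) :
  vfield (hamiltonian_field H) H = 0.
Proof.
rewrite /vfield big_split_ord /= -big_split /= big1 // => k _.
by rewrite hamiltonian_field_q hamiltonian_field_p mulNr mulrC subrr.
Qed.

(** On the left, the flow applied to the chart expressions of x, y, z, w; on the right, 4 s^2 times
    the Sasano vector field there. Here [i] is 1/5 and [X], [O] are x and w. *)
Fact flow_coords_aux (B : comPzRingType)
    (s e i et ze x om dx dom : B) :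
    5 * i = 1 ->
    5 * dx = - (et *+ 8) - ze *+ 4 -> 5 * dom = (et + ze) *+ 4 ->
    let X := e * (s * x) - (i * s ^+ 2) *+ 2 in
    let O := e * (s * om) - (i * s ^+ 2) *+ 2 in
  [/\ e * (2 * s * x + s * (4 * s ^+ 3 * dx - x *+ 2 +
        4 * s ^+ 2 * e * ((x * et) *+ 4 + (ze * om) *+ 2)))
      - (i * (2 * s * s + s * (2 * s))) *+ 2 =
      4 * s ^+ 2 * (4 * X * (e * et) - 2 * i + 2 * (e * ze) * O),
      e * (4 * s ^+ 3 * (- (x *+ 4) - om) - 0 + 4 * s ^+ 2 * e * - (et ^+ 2 *+ 2)) =
      4 * s ^+ 2 * (- 2 * (e * et) ^+ 2 - 4 * X - 2 * s ^+ 2 - O),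
      e * (4 * s ^+ 3 * (x - om) - 0 + 4 * s ^+ 2 * e * (ze ^+ 2 + (et * ze) *+ 2)) =
      4 * s ^+ 2 * ((e * ze) ^+ 2 - O + X + 2 * (e * et) * (e * ze))
    & e * (2 * s * om + s * (4 * s ^+ 3 * dom - om *+ 2 +
        4 * s ^+ 2 * e * (- ((ze * om) *+ 2) - (et * om) *+ 2)))
      - (i * (2 * s * s + s * (2 * s))) *+ 2 =
      4 * s ^+ 2 * (- 2 * (e * ze) * O - 2 * i - 2 * (e * et) * O)].
Proof.
move=> Hi Hx Ho X O.
have inv5 a b : 5 * a = b -> a = i * b.
  by move=> <-; rewrite mulrA [i * 5]mulrC Hi mul1r.
rewrite (inv5 _ _ Hx) (inv5 _ _ Ho) /X /O.
split; [ring| |ring|ring].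
(* In the equation of y the rational solution leaves (10 i - 2) s^2, which vanishes only because i =
   1/5. *)
apply: subr0_eq; transitivity ((5 * i - 1) * (- 8 * s ^+ 4)); first ring.
by rewrite Hi subrr mul0r.
Qed.

(* [s] is a square root of [t], [e] scales the variations; the sum is the
   derivation [4 s^2 d/dt] expressed by its Airy terms [a], [c], by [b = d/ds]
   and by its nonlinear terms [d]. *)
Definition flow_comb (B : comPzRingType) (s e a b c d : B) :=
  4 * s ^+ 3 * a + 2 * s * b + (- 1) * c + 4 * s ^+ 2 * e * d.

Section FlowComb.
Variables (B : comPzRingType) (s e : B).

Fact flow_comb_emb a c d :
  flow_comb s e a 0 c d = 4 * s ^+ 3 * a - c + 4 * s ^+ 2 * e * d.
Proof. by rewrite /flow_comb; ring. Qed.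

Fact flow_comb0 : flow_comb s e 0 0 0 0 = 0.
Proof. by rewrite /flow_comb; ring. Qed.

Fact flow_comb_s : flow_comb s e 0 1 0 0 = 2 * s.
Proof. by rewrite /flow_comb; ring. Qed.

End FlowComb.

Section Flow.
Variables (B : comNzRingType) (dE dN dG : B -> B).
Hypotheses (derE : derivation_along id dE) (derN : derivation_along id dN)
  (derG : derivation_along id dG).
Local Notation C := {poly {poly B}}.
Local Notation emb p := (p%:P%:P : C).
Local Notation ss := ('X%:P : C).
Local Notation eps := ('X : C).
Local Notation lift2 d := (map_poly (map_poly d)).

(** The inner variable is s and the outer one is [eps]. The factor 4 s^2 keeps d/dt = (1 / 2s) d/ds
    and the Airy terms polynomial. *)
Definition flow (f : C) : C :=
  flow_comb ss eps (lift2 dE f) (map_poly deriv f) (lift2 dN f) (lift2 dG f).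

Lemma derivation_lift2 d :
  derivation_along id d -> derivation_along id (lift2 d : C -> C).
Proof. by move=> dd; do 2!apply: derivation_map_poly. Qed.

Lemma flow_derivation : derivation_along id flow.
Proof.
do ![apply: derivationD]; apply: derivationMl; try exact: derivation_lift2.
by apply: derivation_map_poly; exact: derivation_deriv.
Qed.

Lemma lift2_emb d p : derivation_along id d -> lift2 d (emb p) = emb (d p).
Proof.
move=> dd; rewrite derivation_mapC; last exact: derivation_map_poly.
by rewrite derivation_mapC.
Qed.

Lemma flow_emb p : flow (emb p) =
  4 * ss ^+ 3 * emb (dE p) - emb (dN p) + 4 * ss ^+ 2 * eps * emb (dG p).
Proof.
rewrite /flow !lift2_emb // derivation_mapC; last exact: derivation_deriv.
by rewrite derivC flow_comb_emb.
Qed.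

Lemma flow_emb0 p : dE p = 0 -> dN p = 0 -> dG p = 0 -> flow (emb p) = 0.
Proof. by move=> E0 N0 G0; rewrite flow_emb E0 N0 G0 !polyC0 !mulr0 subrr addr0. Qed.

Lemma flow_ss : flow ss = 2 * ss.
Proof.
have lift_ss d : derivation_along id d -> lift2 d ss = 0.
  move=> dd; rewrite derivation_mapC; last exact: derivation_map_poly.
  by rewrite derivation_mapX.
rewrite /flow !lift_ss // derivation_mapC; last exact: derivation_deriv.
by rewrite derivX polyC1 flow_comb_s.
Qed.

Lemma flow_eps : flow eps = 0.
Proof.
have lift_eps d : derivation_along id d -> lift2 d eps = 0.
  by move=> dd; rewrite derivation_mapX //; exact: derivation_map_poly.
rewrite /flow !lift_eps // derivation_mapX ?flow_comb0 //.
exact: derivation_deriv.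
Qed.

(** The nonlinear terms carry a factor [eps], so the lowest power of [eps] sees only the linear
    equations and the part of the cofactor at [eps] = 0. *)
Lemma flow_leading (f g : C) k : (forall j, (j < k)%N -> f`_j = 0) ->
    flow f = 4 * ss ^+ 2 * (g * f) ->
  ('X^3 * map_poly dE f`_k) *+ 4 + ('X * (f`_k)^`()) *+ 2 - map_poly dN f`_k
  = ('X^2 * (g`_0 * f`_k)) *+ 4.
Proof.
move=> fj0 /(congr1 (fun p : C => p`_k)).
have lift0 d : derivation_along id d -> map_poly d 0 = 0.
  by move=> dd; apply: derivation0; exact: derivation_map_poly.
have coef_lift d j : derivation_along id d ->
    (map_poly (map_poly d) f)`_j = map_poly d f`_j.
  by move=> dd; rewrite coef_map_id0 // lift0.
have coef_pow a m (p : C) : (a%:R * ss ^+ m * p)`_k = a%:R * 'X^m * p`_k.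
  by rewrite -polyC_exp -[a%:R]polyC_natr -polyCM coefCM.
have coef_2s (p : C) : (2 * ss * p)`_k = 2 * 'X * p`_k.
  by rewrite -{1}[ss]expr1 coef_pow expr1.
rewrite /flow /flow_comb !coefD coef_pow coef_2s.
rewrite mulN1r coefN -[_ * eps * _]mulrA !coef_pow !coef_lift //.
have -> : ('X * lift2 dG f)`_k = 0.
  rewrite coefXM; case: ifPn => // k0.
  by rewrite coef_lift // fj0 ?lift0 // ltn_predL lt0n.
have -> : (map_poly deriv f)`_k = (f`_k)^`() by rewrite coef_map_id0 // deriv0.
have -> : (g * f)`_k = g`_0 * f`_k.
  rewrite coefM big_ord_recl /= subn0 big1 ?addr0 // => i _.
  by rewrite fj0 ?mulr0 // ltn_subrL /= (leq_ltn_trans _ (ltn_ord i)).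
rewrite mulr0 addr0 => E; transitivity
  (4 * 'X^3 * map_poly dE f`_k + 2 * 'X * (f`_k)^`() - map_poly dN f`_k).
  by ring.
by rewrite E; ring.
Qed.

Variables (K : numFieldType) (cst : {rmorphism K -> B}) (h : B).
Variables (eta zeta xi omega : B).
Hypotheses (constE : forall c, dE (cst c) = 0) (constN : forall c, dN (cst c) = 0)
  (constG : forall c, dG (cst c) = 0)
  (hE : dE h = 0) (hN : dN h = 0) (hG : dG h = 0)
  (formE : [/\ dE eta = - (xi *+ 4) - omega, dE zeta = xi - omega,
      5 * dE xi = - (eta *+ 8) - zeta *+ 4
    & 5 * dE omega = (eta + zeta) *+ 4])
  (formN : [/\ dN eta = 0, dN zeta = 0, dN xi = xi *+ 2
    & dN omega = omega *+ 2])
  (formG : [/\ dG eta = - (eta ^+ 2 *+ 2), dG zeta = zeta ^+ 2 + (eta * zeta) *+ 2,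
      dG xi = (xi * eta) *+ 4 + (zeta * omega) *+ 2
    & dG omega = - ((zeta * omega) *+ 2) - (eta * omega) *+ 2]).

Local Notation i5 := (emb (cst 5^-1)).

Definition chart_x : C := eps * (ss * emb xi) - (i5 * ss ^+ 2) *+ 2.
Definition chart_y : C := eps * emb eta.
Definition chart_z : C := eps * emb zeta.
Definition chart_w : C := eps * (ss * emb omega) - (i5 * ss ^+ 2) *+ 2.
Definition chart_t : C := ss ^+ 2.

Definition chart_H : C :=
  2 * chart_x * chart_y ^+ 2 + 2 * chart_x ^+ 2 + 2 * chart_t * chart_x
  - 2 * i5 * chart_y
  + chart_z ^+ 2 * chart_w - emb (cst 2^-1) * chart_w ^+ 2 + 2 * i5 * chart_z
  + chart_x * chart_w
  + 2 * chart_y * chart_z * chart_w.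

(* Trading the coordinate [F] for the energy [h] makes [h] a constant. *)
Definition chart_F : C := emb h - chart_H.

Definition chart_coords (j : 'I_(3 + 3)) : C :=
  match split j with
  | inl k => nth 0 [:: chart_x; chart_z; chart_t] k
  | inr k => nth 0 [:: chart_y; chart_w; chart_F] k
  end.

Definition sasano_chart : {mpoly K[3 + 3]} -> C :=
  mmap (polyC \o polyC \o cst) chart_coords.

HB.instance Definition _ :=
  GRing.RMorphism.copy sasano_chart (mmap (polyC \o polyC \o cst) chart_coords).

Lemma sasano_chartC c : sasano_chart c%:MP = emb (cst c).
Proof. by rewrite /sasano_chart mmapC. Qed.

Lemma sasano_chart_coords :
  [/\ sasano_chart (sx K) = chart_x, sasano_chart (sy K) = chart_y,
      sasano_chart (sz K) = chart_z
    & [/\ sasano_chart (sw K) = chart_w, sasano_chart (st K) = chart_t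
        & sasano_chart (sF K) = chart_F]].
Proof.
have chart_q k : sasano_chart 'X_(qidx k) = nth 0 [:: chart_x; chart_z; chart_t] k.
  by rewrite /sasano_chart mmapX mmap1U /chart_coords (unsplitK (inl k)).
have chart_p k : sasano_chart 'X_(pidx k) = nth 0 [:: chart_y; chart_w; chart_F] k.
  by rewrite /sasano_chart mmapX mmap1U /chart_coords (unsplitK (inr k)).
by rewrite /sx /sy /sz /sw /st /sF !chart_q !chart_p.
Qed.

Lemma sasano_chart_H : sasano_chart (sasano_H (2 / 5) (1 / 5)) = chart_H.
Proof.
have [Px Py Pz [Pw Pt _]] := sasano_chart_coords.
rewrite /sasano_H !rmorphD !rmorphN !rmorphM /=.
rewrite !sasano_chartC !rmorph_nat Px Py Pz Pw Pt.
by rewrite rmorph1 !polyC1 mul1r.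
Qed.

Lemma sasano_chart_Hhat : sasano_chart (sasano_Hhat (2 / 5) (1 / 5)) = emb h.
Proof.
have [_ _ _ [_ _ PF]] := sasano_chart_coords.
by rewrite /sasano_Hhat rmorphD /= sasano_chart_H PF /chart_F addrC subrK.
Qed.

Local Notation Hhat := (sasano_Hhat (2 / 5) (1 / 5) : {mpoly K[3 + 3]}).
Local Notation D := (vfield (hamiltonian_field Hhat)).

Definition intertwined p := flow (sasano_chart p) = 4 * ss ^+ 2 * sasano_chart (D p).

Lemma intertwinedD p q :
  intertwined p -> intertwined q -> intertwined (p + q).
Proof.
rewrite /intertwined => Hp Hq.
by rewrite vfieldD !rmorphD /= flow_derivation.1 Hp Hq mulrDr.
Qed.

Lemma intertwinedM p q :
  intertwined p -> intertwined q -> intertwined (p * q).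
Proof.
rewrite /intertwined => Hp Hq.
have -> : D (p * q) = D p * q + p * D q by exact: (derivation_sum _).2.
rewrite rmorphM flow_derivation.2 Hp Hq rmorphD 2!rmorphM.
by rewrite mulrDr mulrA (mulrCA (4 * _)).
Qed.

Lemma intertwinedC c : intertwined c%:MP.
Proof.
rewrite /intertwined sasano_chartC flow_emb0 // /vfield big1 ?rmorph0 ?mulr0 // => i _.
by rewrite mderivC mulr0.
Qed.

Lemma intertwined_coords :
  [/\ intertwined (sx K), intertwined (sy K), intertwined (sz K),
      intertwined (sw K) & intertwined (st K)].
Proof.
have [Hx Hy Hz Hw [Ht _]] := sasano_system (2 / 5 : K) (1 / 5).
have [Px Py Pz [Pw Pt _]] := sasano_chart_coords.
have [Ex Ey Ez Ew] := formE.
have [Nx Ny Nz Nw] := formN.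
have [Gx Gy Gz Gw] := formG.
have df := flow_derivation; have [fD fM] := df.
have f_eps p : flow (eps * p) = eps * flow p.
  by rewrite fM flow_eps mul0r add0r.
have f_ss p : flow (ss * p) = 2 * ss * p + ss * flow p by rewrite fM flow_ss.
have f_i5 : flow (- ((i5 * ss ^+ 2) *+ 2)) =
    - ((i5 * (2 * ss * ss + ss * (2 * ss))) *+ 2).
  rewrite (derivationN _ df) mulr2n fD -mulr2n fM flow_emb0 // mul0r add0r.
  by rewrite expr2 f_ss flow_ss.
have Hi : 5 * i5 = 1 :> C.
  have five_neq0 : 5 != 0 :> K by rewrite pnatr_eq0.
  have := congr1 (fun c => emb (cst c)) (mulfV five_neq0).
  by rewrite rmorphM !polyCM rmorph_nat !polyC_natr rmorph1.
have embE p q : 5 * p = q -> 5 * emb p = emb q.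
  by move=> <-; rewrite !polyCM !polyC_natr.
have Hdx : 5 * emb (dE xi) = - (emb eta *+ 8) - emb zeta *+ 4 :> C.
  by rewrite (embE _ _ Ez) 2!polyCB 2!polyCN !polyCMn.
have Hdo : 5 * emb (dE omega) = (emb eta + emb zeta) *+ 4 :> C.
  by rewrite (embE _ _ Ew) 2!polyCMn 2!polyCD.
have [Rx Ry Rz Rw] :=
  @flow_coords_aux C ss eps i5 _ _ (emb xi) (emb omega) _ _ Hi Hdx Hdo.
rewrite /intertwined /sx /sy /sz /sw /st !vfieldX Hx Hy Hz Hw Ht.
rewrite -/(sx K) -/(sy K) -/(sz K) -/(sw K) -/(st K) Px Py Pz Pw Pt.
rewrite !(rmorphD, rmorphN, rmorphM, rmorph1, rmorphXn, rmorph_nat) /=.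
rewrite !sasano_chartC Px Py Pz Pw Pt.
split.
- apply: etrans (etrans _ Rx) _; last first.
    by rewrite /chart_x /chart_y /chart_z /chart_w; ring.
  by rewrite /chart_x fD f_i5 f_eps f_ss flow_emb Nz Gz; ring.
- apply: etrans (etrans _ Ry) _; last first.
    by rewrite /chart_x /chart_y /chart_z /chart_w /chart_t; ring.
  by rewrite /chart_y f_eps flow_emb Ex Nx Gx; ring.
- apply: etrans (etrans _ Rz) _; last first.
    by rewrite /chart_x /chart_y /chart_z /chart_w; ring.
  by rewrite /chart_z f_eps flow_emb Ey Ny Gy; ring.
- apply: etrans (etrans _ Rw) _; last first.
    by rewrite /chart_x /chart_y /chart_z /chart_w; ring.
  by rewrite /chart_w fD f_i5 f_eps f_ss flow_emb Nw Gw; ring.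
- by rewrite /chart_t expr2 f_ss flow_ss mulr1; ring.
Qed.

Lemma intertwinedN p : intertwined p -> intertwined (- p).
Proof.
by move=> Hp; rewrite -mulN1r -mpolyC1 -mpolyCN; apply: intertwinedM Hp;
  exact: intertwinedC.
Qed.

(** The property passes to sums and products, so the coordinates suffice. *)
Lemma intertwinedP p : intertwined p.
Proof.
have [Ix Iy Iz Iw It] := intertwined_coords.
have natI k : intertwined k%:R by rewrite -mpolyC_nat; exact: intertwinedC.
have HI : intertwined (sasano_H (2 / 5) (1 / 5)).
  have sqI q : intertwined q -> intertwined (q ^+ 2).
    by move=> Iq; rewrite expr2; exact: intertwinedM.
  have T1 := intertwinedM (intertwinedM (natI 2%N) Ix) (sqI _ Iy).
  have T2 := intertwinedM (natI 2%N) (sqI _ Ix).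
  have T3 := intertwinedM (intertwinedM (natI 2%N) It) Ix.
  have T4 := intertwinedN
    (intertwinedM (intertwinedM (natI 2%N) (intertwinedC (1 / 5))) Iy).
  have T5 := intertwinedM (sqI _ Iz) Iw.
  have T6 := intertwinedN (intertwinedM (intertwinedC 2^-1) (sqI _ Iw)).
  have T7 := intertwinedM (intertwinedC (2 / 5)) Iz.
  have T9 := intertwinedM (intertwinedM (intertwinedM (natI 2%N) Iy) Iz) Iw.
  have S4 := intertwinedD (intertwinedD (intertwinedD T1 T2) T3) T4.
  have S7 := intertwinedD (intertwinedD (intertwinedD S4 T5) T6) T7.
  exact: intertwinedD (intertwinedD S7 (intertwinedM Ix Iw)) T9.
(* [F] is the energy minus a polynomial in the other coordinates, and both flows annihilate the
   energy; this replaces a direct computation of dF/ds. *)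
have FI : intertwined (sF K).
  have -> : sF K = Hhat - sasano_H (2 / 5) (1 / 5).
    by rewrite /sasano_Hhat addrC addKr.
  apply: intertwinedD (intertwinedN HI); rewrite /intertwined sasano_chart_Hhat.
  have -> : D Hhat = 0 by exact: hamiltonian_energy.
  by rewrite (flow_emb0 hE hN hG) rmorph0 mulr0.
move: p; apply: mpoly_ring_ind => [c|i|p q|p q].
- exact: intertwinedC.
- rewrite -(splitK i).
  case: (split i) => [[[|[|[|k]]] lti]|[[|[|[|k]]] lti]];
    try by exfalso; move: lti; rewrite 3!ltnS ltn0.
  + rewrite (bool_irrelevance lti isT); exact Ix.
  + rewrite (bool_irrelevance lti isT); exact Iz.
  + rewrite (bool_irrelevance lti isT); exact It.
  + rewrite (bool_irrelevance lti isT); exact Iy.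
  + rewrite (bool_irrelevance lti isT); exact Iw.
  + rewrite (bool_irrelevance lti isT); exact FI.
- exact: intertwinedD.
- exact: intertwinedM.
Qed.

End Flow.

(** * Powers of s against degrees in the variations *)

Section Graded.
Variable K : numFieldType.
Local Notation W := {mpoly {poly K}[4]}.
Local Notation C := {poly {poly W}}.
Implicit Types f g : C.

(* Where [u_+ = u_-] and [v_+ = v_-], the chart involves the scaling [eps] of the
   variations only through [eps * s]; and it is even in [s] at [eps = 0]. *)
Definition graded f := forall k n, let w := f`_k`_n in
  [/\ w \is k.-homog, (n < k)%N -> fold_pm w = 0 & k = 0 -> odd n -> w = 0].

Lemma gradedD f g : graded f -> graded g -> graded (f + g).
Proof.
move=> gf gg k n /=; have [f1 f2 f3] := gf k n; have [g1 g2 g3] := gg k n.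
rewrite 2!coefD; split=> [|ltnk|k0 n_odd]; first exact: rpredD.
  by rewrite rmorphD /= f2 ?g2 ?addr0.
by rewrite f3 ?g3 ?addr0.
Qed.

Lemma gradedN f : graded f -> graded (- f).
Proof.
move=> gf k n /=; have [f1 f2 f3] := gf k n.
rewrite 2!coefN; split=> [|ltnk|k0 n_odd]; first by rewrite rpredN.
  have -> : fold_pm (- f`_k`_n) = - fold_pm f`_k`_n by exact: rmorphN.
  by rewrite f2 ?oppr0.
by rewrite f3 ?oppr0.
Qed.

(** If n < k, every splitting of n and k leaves one factor with its power of s below its power of
    [eps]; if n is odd, one of its two summands is odd. *)
Lemma gradedM f g : graded f -> graded g -> graded (f * g).
Proof.
move=> gf gg k n /=; rewrite coefM coef_sum.
have -> : \sum_(i < k.+1) (f`_i * g`_(k - i))`_n =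
    \sum_(i < k.+1) \sum_(j < n.+1) f`_i`_j * g`_(k - i)`_(n - j).
  by apply: eq_bigr => i _; rewrite coefM.
split=> [|ltnk|k0 n_odd].
- apply: rpred_sum => i _; apply: rpred_sum => j _.
  have [f1 _ _] := gf i j; have [g1 _ _] := gg (k - i)%N (n - j)%N.
  by have := dhomogM f1 g1; rewrite subnKC // -ltnS.
- rewrite rmorph_sum /= big1 // => i _; rewrite rmorph_sum /= big1 // => j _.
  rewrite rmorphM /=; have [_ f2 _] := gf i j.
  have [_ g2 _] := gg (k - i)%N (n - j)%N.
  have [lt|ge] := ltnP j i; first by rewrite f2 // mul0r.
  rewrite g2 ?mulr0 //; move: ge ltnk (ltn_ord i) (ltn_ord j); clear; lia.
- rewrite big1 // => i _; rewrite big1 // => j _.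
  have [_ _ f3] := gf i j; have [_ _ g3] := gg (k - i)%N (n - j)%N.
  have i0 : i = 0%N :> nat by apply/eqP; rewrite -leqn0 -[X in (_ <= X)%N]k0 -ltnS.
  have [oj|ej] := boolP (odd j); first by rewrite f3 ?mul0r.
  rewrite g3 ?mulr0 //; first by rewrite i0 subn0.
  by rewrite oddB ?n_odd ?(negPf ej) // -ltnS.
Qed.

Lemma graded_monomial k n (w : W) :
    w \is k.-homog -> ((n < k)%N -> fold_pm w = 0) -> (k = 0%N -> ~~ odd n) ->
  graded ('X^k * ('X^n * w%:P)%:P).
Proof.
move=> w1 w2 w3 i j /=.
have -> : ('X^k * ('X^n * w%:P)%:P : C)`_i`_j =
    if (i == k) && (j == n) then w else 0.
  rewrite coefXnM; case: ltngtP => [|lt|->] /=; rewrite ?coef0 //.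
    by rewrite coefC subn_eq0 leqNgt lt coef0.
  rewrite subnn coefC eqxx coefXnM; case: ltngtP => [|lt|->] //=.
    by rewrite coefC subn_eq0 leqNgt lt.
  by rewrite subnn coefC eqxx.
case: ifP => [/andP[/eqP-> /eqP->]|_]; last first.
  by split=> *; rewrite ?rmorph0 ?rpred0.
by split=> // k0; rewrite (negPf (w3 k0)).
Qed.

Lemma graded0homog (w : W) : w \is 0.-homog -> graded w%:P%:P.
Proof.
by move=> w0; have := @graded_monomial 0 0 w w0; rewrite !expr0 !mul1r; apply.
Qed.

End Graded.

Section Claim.
Variables (K : numFieldType) (rho mu1 mu2 : K).
Hypotheses (rho2 : 5 * rho ^+ 2 = 1)
  (mu1_gt : 0 < mu1 ^+ 2) (mu2_lt : mu2 ^+ 2 < 0)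
  (mu1E : mu1 ^+ 2 = 2 + 6 * rho) (mu2E : mu2 ^+ 2 = 2 - 6 * rho).
Local Notation W := {mpoly {poly K}[4]}.
Local Notation C := {poly {poly W}}.
Local Notation emb p := (p%:P%:P : C).
Local Notation ss := ('X%:P : C).
Local Notation eps := ('X : C).
Local Notation Hhat := (sasano_Hhat (2 / 5) (1 / 5) : {mpoly K[3 + 3]}).
Local Notation D := (vfield (hamiltonian_field Hhat)).

(** * Darboux polynomials *)

(** The energy is the variable of [{poly K}], hence a constant for the three vector fields. *)
Definition airy_chart : {mpoly K[3 + 3]} -> C :=
  sasano_chart (@mpolyC 4 {poly K} \o polyC) 'X%:MP (eta K) (zeta rho)
    (xi rho mu1 mu2) (omega rho mu1 mu2).

HB.instance Definition _ := GRing.RMorphism.copy airy_chart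
  (sasano_chart (@mpolyC 4 {poly K} \o polyC) 'X%:MP (eta K) (zeta rho)
    (xi rho mu1 mu2) (omega rho mu1 mu2)).

Lemma airy_chartC c : airy_chart c%:MP = emb (c%:P%:MP).
Proof. exact: sasano_chartC. Qed.

Lemma airy_chartD p q : airy_chart (p + q) = airy_chart p + airy_chart q.
Proof. exact: (rmorphD (sasano_chart _ _ _ _ _ _)). Qed.

Lemma airy_chartM p q : airy_chart (p * q) = airy_chart p * airy_chart q.
Proof. exact: (rmorphM (sasano_chart _ _ _ _ _ _)). Qed.

Definition airy_flow : C -> C :=
  flow (vfield (airy_main mu1 mu2)) (vfield (@airy_sub K))
    (vfield (airy_quad rho mu1 mu2)).

Lemma airy_chart_flow p :
  airy_flow (airy_chart p) = 4 * ss ^+ 2 * airy_chart (D p).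
Proof.
have vfC n (q : 'I_n -> {mpoly {poly K}[n]}) c : vfield q c%:MP = 0.
  by rewrite /vfield big1 // => i _; rewrite mderivC mulr0.
apply: intertwinedP; try (by move=> ?; exact: vfC); try exact: vfC;
  try exact: derivation_sum.
- exact: airy_main_form.
- exact: airy_sub_form.
- exact: airy_quad_form.
Qed.

Lemma airy_chart_Hhat : airy_chart Hhat = emb ('X%:MP).
Proof. exact: sasano_chart_Hhat. Qed.

Lemma homog_linear : [/\ u0 K \is 1.-homog, v0 K \is 1.-homog,
  u1 mu1 \is 1.-homog & v1 mu2 \is 1.-homog].
Proof.
have hX (i : 'I_4) : ('X_i : W) \is 1.-homog by rewrite dhomogX /= mdeg1.
rewrite /u0 /v0 /u1 /v1 !mul_mpolyC.
split; [apply: rpredB|apply: rpredB|apply: rpredZ; apply: rpredD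
  |apply: rpredZ; apply: rpredD]; exact: hX.
Qed.

Lemma homog_forms : [/\ eta K \is 1.-homog, zeta rho \is 1.-homog,
  xi rho mu1 mu2 \is 1.-homog & omega rho mu1 mu2 \is 1.-homog].
Proof.
have [h1 h2 h3 h4] := homog_linear.
have hZ (p : W) c : p \is 1.-homog -> c%:MP * p \is 1.-homog.
  by move=> hp; rewrite mul_mpolyC rpredZ.
have hMn (p : W) k : p \is 1.-homog -> p *+ k \is 1.-homog.
  by move=> hp; rewrite rpredMn.
have hD (p q : W) : p \is 1.-homog -> q \is 1.-homog -> p + q \is 1.-homog.
  by move=> hp hq; apply: rpredD.
have hB (p q : W) : p \is 1.-homog -> q \is 1.-homog -> p - q \is 1.-homog.
  by move=> hp hq; apply: rpredB.
split.
- by apply: (hD); apply: (hMn).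
- by apply: (hB); apply: (hMn); [apply: (hZ); exact: (hB) | exact: (hD)].
- by apply: (hB); [apply: (hZ); exact: (hB) | exact: (hD)].
- by apply: (hB); apply: (hMn); [exact: (hD) | apply: (hZ); exact: (hB)].
Qed.

(** The chart expressions of y and z carry [eps] without s; their vanishing here is what makes them
    graded. *)
Lemma fold_forms : fold_pm (eta K) = 0 /\ fold_pm (zeta rho) = 0.
Proof.
have fX (i : 'I_4) : fold_pm ('X_i : W) = if (i < 2)%N then 1 else 'X.
  by rewrite /fold_pm mmapX mmap1U.
have [fX0 fX1 fX2 fX3] : [/\ fold_pm ('X_o0 : W) = 1, fold_pm ('X_o1 : W) = 1,
    fold_pm ('X_o2 : W) = 'X & fold_pm ('X_o3 : W) = 'X].
  by rewrite !fX.
have fB (p q : W) : fold_pm (p - q) = fold_pm p - fold_pm q.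
  exact: rmorphB.
have fD (p q : W) : fold_pm (p + q) = fold_pm p + fold_pm q.
  exact: rmorphD.
have fM (p q : W) : fold_pm (p * q) = fold_pm p * fold_pm q.
  exact: rmorphM.
have fMn (p : W) k : fold_pm (p *+ k) = fold_pm p *+ k.
  exact: rmorphMn.
have f0 : fold_pm (u0 K) = 0 by rewrite /u0 fB fX0 fX1 subrr.
have f1 : fold_pm (v0 K) = 0 by rewrite /v0 fB fX2 fX3 subrr.
rewrite /eta /zeta; move: (u0 K) (v0 K) f0 f1 => u v f0 f1; split.
  by rewrite fD !fMn f0 f1 !mul0rn addr0.
by rewrite fB !fMn fM fB fD f0 f1 subrr mulr0 addr0 !mul0rn subrr.
Qed.

Lemma homogC c : (c%:MP : W) \is 0.-homog.
Proof. by rewrite -[c%:MP]mulr1 mul_mpolyC rpredZ // dhomog1. Qed.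

Lemma gradedC c : graded (emb (c%:MP : W)).
Proof. by apply: graded0homog; exact: homogC. Qed.

Lemma graded_chart p : graded (airy_chart p).
Proof.
have [h1 h2 h3 h4] := homog_forms; have [f1 f2] := fold_forms.
have gn k : graded (k%:R : C).
  by rewrite -!polyC_natr -mpolyC_nat; exact: gradedC.
have gI c : graded (emb (c%:MP : W) * ss ^+ 2 *+ 2).
  rewrite -mulr_natl; apply: gradedM => //; rewrite mulrC.
  have := @graded_monomial K 0 2 c%:MP (homogC c).
  by rewrite expr0 mul1r polyCM polyC_exp; apply.
have g_eps (w : W) : w \is 1.-homog -> fold_pm w = 0 -> graded (eps * emb w).
  move=> hw fw; have := @graded_monomial K 1 0 w hw.
  by rewrite expr0 mul1r expr1; apply.
have g_eps_ss (w : W) : w \is 1.-homog -> graded (eps * (ss * emb w)).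
  move=> hw; have := @graded_monomial K 1 1 w hw.
  by rewrite !expr1 polyCM; apply.
have gt : graded (ss ^+ 2 : C).
  have := @graded_monomial K 0 2 1 (dhomog1 _ _).
  by rewrite expr0 mul1r polyC1 mulr1 polyC_exp; apply.
have gx := gradedD (g_eps_ss _ h3) (gradedN (gI (5^-1)%:P)).
have gw := gradedD (g_eps_ss _ h4) (gradedN (gI (5^-1)%:P)).
have gy := g_eps _ h1 f1; have gz := g_eps _ h2 f2.
have sqg (f : C) : graded f -> graded (f ^+ 2).
  by move=> gf; rewrite expr2; exact: gradedM.
have T1 := gradedM (gradedM (gn 2%N) gx) (sqg _ gy).
have T2 := gradedM (gn 2%N) (sqg _ gx).
have T3 := gradedM (gradedM (gn 2%N) gt) gx.
have T4 := gradedN (gradedM (gradedM (gn 2%N) (gradedC (5^-1)%:P)) gy).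
have T5 := gradedM (sqg _ gz) gw.
have T6 := gradedN (gradedM (gradedC (2^-1)%:P) (sqg _ gw)).
have T7 := gradedM (gradedM (gn 2%N) (gradedC (5^-1)%:P)) gz.
have T8 := gradedM gx gw.
have T9 := gradedM (gradedM (gradedM (gn 2%N) gy) gz) gw.
have gH := gradedD (gradedD (gradedD (gradedD (gradedD (gradedD (gradedD
  (gradedD T1 T2) T3) T4) T5) T6) T7) T8) T9.
have gF := gradedD (gradedC 'X) (gradedN gH).
move: p; apply: mpoly_ring_ind => [c|i|p q gp gq|p q gp gq].
- by rewrite airy_chartC; exact: gradedC.
- rewrite /airy_chart /sasano_chart mmapX mmap1U /chart_coords.
  case: split => [[[|[|[|k]]] lti]|[[|[|[|k]]] lti]].
  + exact: gx.
  + exact: gz.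
  + exact: gt.
  + by exfalso; move: lti; rewrite 3!ltnS ltn0.
  + exact: gy.
  + exact: gw.
  + exact: gF.
  + by exfalso; move: lti; rewrite 3!ltnS ltn0.
- by rewrite airy_chartD; exact: gradedD.
- by rewrite airy_chartM; exact: gradedM.
Qed.

Lemma darboux_leading p r : airy_chart p != 0 -> D p = r * p ->
  exists2 c, c != 0 & (airy_chart p)`_0 = c%:MP%:P.
Proof.
set f := airy_chart p => f0 Dp; have gf : graded f := graded_chart p.
pose g := airy_chart r; have gg : graded g := graded_chart r.
have /ex_minnP[k fk0 k_min] : exists k, f`_k != 0.
  by exists (size f).-1; rewrite -lead_coefE lead_coef_eq0.
have fj0 j : (j < k)%N -> f`_j = 0.
  by move=> ltjk; apply: contraTeq ltjk => /k_min; rewrite leqNgt.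
have flow_f : airy_flow f = 4 * ss ^+ 2 * (g * f).
  by rewrite airy_chart_flow Dp airy_chartM.
have lead_eq := @flow_leading _ _ _ _ (derivation_sum _) (derivation_sum _)
  (derivation_sum _) f g k fj0 flow_f.
have g_odd n : odd n -> g`_0`_n = 0 by have [_ _] := gg 0%N n; apply.
have const_homog (w : W) : w \is 0.-homog -> w = (w@_0%MM)%:MP.
  move=> w0; apply/mpolyP => m; rewrite mcoeffC.
  have [->|m0] := eqVneq m 0%MM; first by rewrite mulr1.
  by rewrite mulr0; apply: (dhomog_nemf_coeff w0); rewrite mdeg_eq0.
have g_const n : exists c, g`_0`_n = c%:MP.
  by have [/const_homog w0 _ _] := gg 0%N n; exists (g`_0`_n)@_0%MM.
have lead := airy_lead mu1_gt mu2_lt fk0 g_odd g_const lead_eq.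
set n := (size f`_k).-1 in lead.
have [hom fold _] := gf k n; rewrite -lead_coefE in hom fold.
have lead0 : lead_coef f`_k != 0 by rewrite lead_coef_eq0.
(* Otherwise gradedness would make the leading coefficient fold to 0, which balanced monomials of
   one degree forbid. *)
have lekn : (k <= n)%N.
  rewrite leqNgt; apply/negP => /fold fold0.
  by move/eqP: fold0; apply/negP; exact: fold_pm_neq0 lead0 lead.
(* The degree in the variations equals the power of [eps], and the Airy equations tie it to twice
   the degree in s. *)
have k2n : k = (n * 2)%N.
  have m_in := mlead_supp lead0; have [_ <-] := lead _ m_in.
  by rewrite (dhomog_mf hom).
have [k0 n0] : k = 0%N /\ n = 0%N by move: lekn k2n; clear; lia.
have sz1 : (size (f`_k)%R <= 1)%N.
  by move: n0; rewrite /n; case: (size _) => [|[]].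
have [hom0 _ _] := gf 0%N 0%N.
have Ef : f`_0 = ((f`_0`_0)@_0%MM)%:MP%:P.
  by rewrite -(const_homog _ hom0); apply: size1_polyC; rewrite k0 in sz1.
exists (f`_0`_0)@_0%MM => //; rewrite k0 in fk0; apply: contraNneq fk0 => c0.
by rewrite Ef c0 mpolyC0 polyC0.
Qed.

End Claim.

(** * Points of the chart and its injectivity *)

Section ChartEval.
Variables (B : comNzRingType) (K : numFieldType) (ev : {rmorphism B -> K}).
Variables (cst : {rmorphism K -> B}) (h eta zeta xi omega : B) (s : K).
Hypothesis evC : forall c, ev (cst c) = c.
Local Notation C := {poly {poly B}}.
Local Notation emb p := (p%:P%:P : C).
Local Notation chart := (sasano_chart cst h eta zeta xi omega).
Local Notation H := (sasano_H (2 / 5) (1 / 5) : {mpoly K[3 + 3]}).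
Local Notation Hhat := (sasano_Hhat (2 / 5) (1 / 5) : {mpoly K[3 + 3]}).

Definition chart_eval : C -> K :=
  horner_eval 1 \o map_poly (horner_eval s \o map_poly ev).

HB.instance Definition _ := GRing.RMorphism.copy chart_eval
  (horner_eval 1 \o map_poly (horner_eval s \o map_poly ev)).

Lemma chart_eval_emb w : chart_eval (emb w) = ev w.
Proof.
by rewrite /chart_eval /= map_polyC /= map_polyC /= /horner_eval !hornerC.
Qed.

Lemma chart_eval_ss : chart_eval 'X%:P = s.
Proof.
rewrite /chart_eval /= map_polyC /= map_polyX /horner_eval.
by rewrite hornerC hornerX.
Qed.

Lemma chart_eval_eps : chart_eval 'X = 1.
Proof. by rewrite /chart_eval /= map_polyX /horner_eval hornerX. Qed.

Lemma chart_evalP (v : 'I_(3 + 3) -> K) :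
    s * ev xi - (5^-1 * s ^+ 2) *+ 2 = (sx K).@[v] ->
    ev eta = (sy K).@[v] -> ev zeta = (sz K).@[v] ->
    s * ev omega - (5^-1 * s ^+ 2) *+ 2 = (sw K).@[v] ->
    s ^+ 2 = (st K).@[v] -> ev h = Hhat.@[v] ->
  forall p, chart_eval (chart p) = p.@[v].
Proof.
move=> Ex Ey Ez Ew Et Eh.
have [Px Py Pz [Pw Pt _]] := sasano_chart_coords cst h eta zeta xi omega.
have Cx : chart_eval (chart (sx K)) = (sx K).@[v].
  rewrite Px /chart_x rmorphB rmorphMn !rmorphM /= !chart_eval_emb chart_eval_ss.
  by rewrite chart_eval_eps mul1r evC -expr2.
have Cw : chart_eval (chart (sw K)) = (sw K).@[v].
  rewrite Pw /chart_w rmorphB rmorphMn !rmorphM /= !chart_eval_emb chart_eval_ss.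
  by rewrite chart_eval_eps mul1r evC -expr2.
have Cy : chart_eval (chart (sy K)) = (sy K).@[v].
  by rewrite Py /chart_y rmorphM /= chart_eval_emb chart_eval_eps mul1r.
have Cz : chart_eval (chart (sz K)) = (sz K).@[v].
  by rewrite Pz /chart_z rmorphM /= chart_eval_emb chart_eval_eps mul1r.
have Ct : chart_eval (chart (st K)) = (st K).@[v].
  by rewrite Pt /chart_t rmorphM /= chart_eval_ss -expr2.
pose agree p := chart_eval (chart p) = p.@[v].
have agC c : agree c%:MP by rewrite /agree sasano_chartC chart_eval_emb evC mevalC.
have agD p q : agree p -> agree q -> agree (p + q).
  by rewrite /agree => Ep Eq; rewrite !rmorphD /= Ep Eq.
have agM p q : agree p -> agree q -> agree (p * q).
  by rewrite /agree => Ep Eq; rewrite !rmorphM /= Ep Eq.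
have agN p : agree p -> agree (- p).
  by move=> Ep; rewrite -mulN1r -mpolyC1 -mpolyCN; exact: agM.
have ag2 : agree 2 by rewrite -mpolyC_nat.
have agX p : agree p -> agree (p ^+ 2) by move=> Ep; rewrite expr2; exact: agM.
have agH : agree H.
  have T1 := agM _ _ (agM _ _ ag2 Cx) (agX _ Cy).
  have T2 := agM _ _ ag2 (agX _ Cx).
  have T3 := agM _ _ (agM _ _ ag2 Ct) Cx.
  have T4 := agN _ (agM _ _ (agM _ _ ag2 (agC (1 / 5))) Cy).
  have T5 := agM _ _ (agX _ Cz) Cw.
  have T6 := agN _ (agM _ _ (agC 2^-1) (agX _ Cw)).
  have T7 := agM _ _ (agC (2 / 5)) Cz.
  have T9 := agM _ _ (agM _ _ (agM _ _ ag2 Cy) Cz) Cw.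
  exact: agD _ _ (agD _ _ (agD _ _ (agD _ _ (agD _ _ (agD _ _ (agD _ _ (agD _ _
    T1 T2) T3) T4) T5) T6) T7) (agM _ _ Cx Cw)) T9.
have agF : agree (sF K).
  have -> : sF K = Hhat - H by rewrite /sasano_Hhat addrC addKr.
  by apply: agD (agN _ agH); rewrite /agree sasano_chart_Hhat chart_eval_emb Eh.
apply: mpoly_ring_ind => // i.
by rewrite -(splitK i); case: (split i) => [[[|[|[|//]]] lti]|[[|[|[|//]]] lti]];
  rewrite (bool_irrelevance lti isT).
Qed.

End ChartEval.

Section Injectivity.
Variables (K : numClosedFieldType) (rho mu1 mu2 : K).
Hypotheses (rho2 : 5 * rho ^+ 2 = 1)
  (mu1_gt : 0 < mu1 ^+ 2) (mu2_lt : mu2 ^+ 2 < 0).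
Local Notation W := {mpoly {poly K}[4]}.
Local Notation Hhat := (sasano_Hhat (2 / 5) (1 / 5) : {mpoly K[3 + 3]}).
Local Notation chart := (airy_chart rho mu1 mu2).

Definition weval (a : 'I_4 -> K) (e : K) : W -> K := mmap (horner_eval e) a.

HB.instance Definition _ a e :=
  GRing.RMorphism.copy (weval a e) (mmap (horner_eval e) a).

Section WevalTheory.
Variables (a : 'I_4 -> K) (e : K).
Implicit Types p q : W.

Lemma wevalC c : weval a e c%:P%:MP = c.
Proof. by rewrite /weval mmapC /= /horner_eval hornerC. Qed.

Lemma wevalX i : weval a e 'X_i = a i.
Proof. by rewrite /weval mmapX mmap1U. Qed.

Lemma wevalD p q : weval a e (p + q) = weval a e p + weval a e q.
Proof. exact: rmorphD. Qed.

Lemma wevalB p q : weval a e (p - q) = weval a e p - weval a e q.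
Proof. exact: rmorphB. Qed.

Lemma wevalM p q : weval a e (p * q) = weval a e p * weval a e q.
Proof. exact: rmorphM. Qed.

Lemma wevalMn p k : weval a e (p *+ k) = weval a e p *+ k.
Proof. exact: rmorphMn. Qed.

End WevalTheory.

(** Once a square root s of t is nonzero, all changes of coordinates can be inverted; the energy is
    set to its value at [v], which recovers F. *)
Lemma chart_point (v : 'I_(3 + 3) -> K) : (st K).@[v] != 0 ->
  exists (ev : {rmorphism W -> K}) s, forall p,
    chart_eval ev s (chart p) = p.@[v].
Proof.
set t := (st K).@[v] => t0; pose s := sqrtC t.
have s2 : s ^+ 2 = t by exact: sqrtCK.
have s0 : s != 0 by rewrite sqrtC_eq0.
have mu1_0 : mu1 != 0.
  by apply: contraTneq mu1_gt => ->; rewrite expr0n ltxx.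
have mu2_0 : mu2 != 0.
  by apply: contraTneq mu2_lt => ->; rewrite expr0n ltxx.
pose x := ((sx K).@[v] + (5^-1 * s ^+ 2) *+ 2) / s.
pose w := ((sw K).@[v] + (5^-1 * s ^+ 2) *+ 2) / s.
have two0 : 2 != 0 :> K by rewrite pnatr_eq0.
have [] := @airy_quad_aux K rho 2^-1 (sy K).@[v] (sz K).@[v] x w.
- by rewrite -expr2.
- by rewrite mulfV.
set U := (rho * _ * (_ + _)); set P := rho * _ * (_ - _ - _).
set V := _ - U; set Q := _ - P => Ey Ez Ex Ew.
pose a (i : 'I_4) : K := nth 0 [:: (P / mu1 + U) / 2; (P / mu1 - U) / 2;
  (Q / mu2 + V) / 2; (Q / mu2 - V) / 2] i.
exists (weval a Hhat.@[v]), s.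
have half_sub (b c : K) : (b + c) / 2 - (b - c) / 2 = c by field.
have half_add (b c d : K) : d != 0 ->
    d * ((b / d + c) / 2 + (b / d - c) / 2) = b by move=> d0; field.
have Eu0 : weval a Hhat.@[v] (u0 K) = U.
  by rewrite /u0 wevalB !wevalX half_sub.
have Ev0 : weval a Hhat.@[v] (v0 K) = V.
  by rewrite /v0 wevalB !wevalX half_sub.
have Eu1 : weval a Hhat.@[v] (u1 mu1) = P.
  by rewrite /u1 wevalM wevalD !wevalX wevalC half_add.
have Ev1 : weval a Hhat.@[v] (v1 mu2) = Q.
  by rewrite /v1 wevalM wevalD !wevalX wevalC half_add.
apply: chart_evalP => //=.
- by move=> c; exact: wevalC.
- rewrite /xi; move: (u1 mu1) (v1 mu2) Eu1 Ev1 => p1 p2 Ep1 Ep2.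
  rewrite wevalB wevalM wevalB wevalD Ep1 Ep2 wevalC Ex.
  by rewrite /x mulrC divfK // addrK.
- rewrite /eta; move: (u0 K) (v0 K) Eu0 Ev0 => p1 p2 Ep1 Ep2.
  by rewrite wevalD !wevalMn Ep1 Ep2.
- rewrite /zeta; move: (u0 K) (v0 K) Eu0 Ev0 => p1 p2 Ep1 Ep2.
  by rewrite wevalB !wevalMn wevalM wevalB wevalD Ep1 Ep2 wevalC.
- rewrite /omega; move: (u1 mu1) (v1 mu2) Eu1 Ev1 => p1 p2 Ep1 Ep2.
  rewrite wevalB !wevalMn wevalM wevalB wevalD Ep1 Ep2 wevalC Ew.
  by rewrite /w mulrC divfK // addrK.
- by rewrite /= /weval mmapC /= /horner_eval hornerX.
Qed.

Lemma airy_chart_neq0 p : p != 0 -> chart p != 0.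
Proof.
(* The factor [st K] keeps the chosen point off t = 0, where the chart cannot be inverted. *)
move=> p0; have pt0 : p * st K != 0.
  rewrite mulf_neq0 //; apply/eqP => /(congr1 (mcoeff U_(qidx (@Ordinal 3 2 isT))%MM)).
  by rewrite mcoeffX eqxx mcoeff0 => /eqP; rewrite oner_eq0.
have [v] := mpoly_nonzero_point pt0; rewrite mevalM mulf_eq0 negb_or.
case/andP=> pv tv; have [ev [s chart_v]] := chart_point tv.
by apply: contraNneq pv => E; rewrite -chart_v E rmorph0.
Qed.

End Injectivity.

Local Notation "x %:F" := (@FracField.tofrac _ x).

(** * First integrals *)

Lemma first_integral_lowest_terms (K : numFieldType) n (H : {mpoly K[n + n]})
    (f : {fraction {mpoly K[n + n]}}) :
  first_integral H f -> exists p q r, [/\ q != 0, f = p%:F / q%:F,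
    vfield (hamiltonian_field H) p = r * p &
    vfield (hamiltonian_field H) q = r * q].
Proof.
move=> fi; have d0 : \d_(repr f) != 0 := denom_ratioP (repr f).
have [g [p [q [Ep Eq qp]]]] := mpoly_lowest_terms \n_(repr f) d0.
have [g0 q0] : g != 0 /\ q != 0.
  by move: d0; rewrite Eq mulf_eq0 negb_or => /andP.
have Ef : f = p%:F / q%:F.
  rewrite [LHS]fracE Ep Eq; apply/eqP.
  by rewrite frac_eqE ?mulf_neq0 //; apply/eqP; ring.
set D := vfield (hamiltonian_field H).
have Dpq : D p * q = p * D q.
  move: fi; rewrite /first_integral Ef.
  under eq_bigr do rewrite (pderivE _ _ q0) mulrA -tofracM.
  rewrite -mulr_suml -rmorph_sum => /eqP; rewrite mulf_eq0 invr_eq0.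
  rewrite !tofrac_eq0 expf_eq0 (negPf q0) andbF orbF => /eqP E.
  apply: subr0_eq; rewrite -[RHS]E /D /vfield mulr_suml mulr_sumr -sumrB.
  by apply: eq_bigr => i _; ring.
(* Coprimality cancels [p] from p * D q, a multiple of [q]; the quotient is then also the cofactor
   of [p]. *)
have [r Dq] : divides q (D q) by apply: qp; exists (D p); rewrite -Dpq.
exists p, q, r; split=> //; apply: (mulIf q0); rewrite Dpq Dq; ring.
Qed.

Section EnergyPolynomials.
Variables (K : numFieldType) (n : nat) (H : {mpoly K[n + n]}).

Definition at_energy (c : {poly K}) : {mpoly K[n + n]} :=
  (map_poly (@mpolyC (n + n) K) c).[H].

Lemma at_energyMXaddC c a : at_energy (c * 'X + a%:P) = at_energy c * H + a%:MP.
Proof.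
by rewrite /at_energy rmorphD rmorphM /= map_polyX map_polyC /= hornerMXaddC.
Qed.

Lemma at_energy0 : at_energy 0 = 0.
Proof. by rewrite /at_energy rmorph0 horner0. Qed.

Lemma at_energyD c d : at_energy (c + d) = at_energy c + at_energy d.
Proof. by rewrite /at_energy rmorphD hornerD. Qed.

Lemma at_energyN c : at_energy (- c) = - at_energy c.
Proof. by rewrite /at_energy rmorphN hornerN. Qed.

Lemma at_energyMX c : at_energy (c * 'X) = at_energy c * H.
Proof. by rewrite -[c * 'X]addr0 -polyC0 at_energyMXaddC mpolyC0 addr0. Qed.

Lemma at_energy_deriv c i :
  (at_energy c)^`M(i) = at_energy c^`() * H^`M(i).
Proof.
elim/poly_ind: c => [|c a IH].
  by rewrite at_energy0 mderiv0 deriv0 at_energy0 mul0r.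
rewrite at_energyMXaddC mderivD mderivC addr0 mderivM IH.
by rewrite derivD derivC addr0 derivM derivX mulr1 at_energyD at_energyMX; ring.
Qed.

Lemma at_energy_invariant c : vfield (hamiltonian_field H) (at_energy c) = 0.
Proof.
transitivity (at_energy c^`() * vfield (hamiltonian_field H) H).
  rewrite /vfield mulr_sumr; apply: eq_bigr => i _.
  by rewrite at_energy_deriv mulrCA.
by rewrite hamiltonian_energy mulr0.
Qed.

End EnergyPolynomials.

Fact polyCCMD (B : nzRingType) (p q r : B) :
  (p * q + r)%:P%:P = p%:P%:P * q%:P%:P + r%:P%:P :> {poly {poly B}}.
Proof. by rewrite !polyCD !polyCM. Qed.

Fact polyCC_cross (B : nzRingType) (f g : {poly {poly B}}) (a b : B) :
    f`_0 = a%:P -> g`_0 = b%:P ->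
  (f * b%:P%:P + (- a)%:P%:P * g)`_0 = 0.
Proof.
move=> Ef Eg; rewrite coefD coefMC coefCM Ef Eg.
by rewrite polyCN mulNr subrr.
Qed.

Section Gradient.
Variables (K : numClosedFieldType) (rho mu1 mu2 : K).
Hypotheses (rho2 : 5 * rho ^+ 2 = 1)
  (mu1_gt : 0 < mu1 ^+ 2) (mu2_lt : mu2 ^+ 2 < 0)
  (mu1E : mu1 ^+ 2 = 2 + 6 * rho) (mu2E : mu2 ^+ 2 = 2 - 6 * rho).
Local Notation Hhat := (sasano_Hhat (2 / 5) (1 / 5) : {mpoly K[3 + 3]}).
Local Notation D := (vfield (hamiltonian_field Hhat)).
Local Notation chart := (airy_chart rho mu1 mu2).
Local Notation iF := (pidx (@Ordinal 3 2 isT)).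

Lemma chart_at_energy c : chart (at_energy Hhat c) = c%:MP%:P%:P.
Proof.
elim/poly_ind: c => [|c a IH].
  by rewrite at_energy0 !rmorph0.
rewrite at_energyMXaddC airy_chartD airy_chartM IH airy_chart_Hhat.
by rewrite airy_chartC mpolyCD mpolyCM; exact: esym (polyCCMD _ _ _).
Qed.

(** Let a and b be the parts of p and q at [eps] = 0. Functions of the energy are invariant, so p
    b(Hhat) - a(Hhat) q has the same cofactor as p and q. Its part at [eps] = 0 vanishes, which no
    nonzero Darboux polynomial allows. *)
Lemma first_integral_energy f : first_integral Hhat f ->
  exists a b, at_energy Hhat b != 0 /\
    f = (at_energy Hhat a)%:F / (at_energy Hhat b)%:F.
Proof.
case/first_integral_lowest_terms => p [q [r [q0 -> Dp Dq]]].
have leading p' : D p' = r * p' ->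
    exists c, (chart p')`_0 = c%:MP%:P /\ (p' != 0 -> c != 0).
  have [->|p0 Dp'] := eqVneq p' 0.
    by exists 0; rewrite rmorph0 coef0 mpolyC0 polyC0.
  have [c c0 Ec] := darboux_leading rho2 mu1_gt mu2_lt mu1E mu2E
    (airy_chart_neq0 rho2 mu1_gt mu2_lt p0) Dp'.
  by exists c.
have [a [Ea _]] := leading _ Dp; have [b [Eb /(_ q0) b0]] := leading _ Dq.
have hb0 : at_energy Hhat b != 0.
  apply: contraNneq b0 => /(congr1 chart); rewrite chart_at_energy rmorph0.
  by move/eqP; rewrite !polyC_eq0 mpolyC_eq0.
exists a, b; split=> //; apply/eqP; rewrite frac_eqE //.
rewrite -subr_eq0 -mulNr -at_energyN; set S := _ + _.
have DS : D S = r * S.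
  have dD := derivation_sum (hamiltonian_field Hhat).
  have DM p1 p2 : D (p1 * p2) = D p1 * p2 + p1 * D p2 by exact: dD.2.
  by rewrite /S vfieldD !DM !at_energy_invariant Dp Dq; ring.
have [c [Ec c0]] := leading _ DS; apply: contraT => /c0.
suff : (chart S)`_0 = 0.
  by rewrite Ec => /eqP; rewrite polyC_eq0 mpolyC_eq0 => ->.
rewrite /S airy_chartD !airy_chartM !chart_at_energy mpolyCN.
exact: polyCC_cross Ea Eb.
Qed.

Lemma mderivF_Hhat : Hhat^`M(iF) = 1.
Proof.
have [_ _ _ _ [<- _]] := sasano_system (2 / 5 : K) (1 / 5).
by rewrite hamiltonian_field_q.
Qed.

(** A function of the energy has gradient proportional to that of Hhat; since dHhat/dF = 1, the
    factor is the derivative in F. *)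
Lemma first_integral_gradient f i : first_integral Hhat f ->
  pderiv i f = pderiv iF f * (Hhat^`M(i))%:F.
Proof.
case/first_integral_energy => a [b [b0 ->]]; rewrite !pderivE //.
rewrite !at_energy_deriv mderivF_Hhat !mulr1 [RHS]mulrAC -tofracM; congr (_%:F / _).
by ring.
Qed.

End Gradient.

(** [rfeval] reads whatever representative [repr] picks, so both denominators must be nonzero at [v]
    before an identity of fractions can be evaluated. *)
Lemma rfeval_mul (K : numFieldType) m (v : 'I_m -> K)
    (f g : {fraction {mpoly K[m]}}) (h : {mpoly K[m]}) :
    (\d_(repr f)).@[v] != 0 -> (\d_(repr g)).@[v] != 0 -> f = g * h%:F ->
  rfeval v f = rfeval v g * h.@[v].
Proof.
move=> df dg E.
have df0 : \d_(repr f) != 0 := denom_ratioP (repr f).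
have dg0 : \d_(repr g) != 0 := denom_ratioP (repr g).
have /eqP : f == (\n_(repr g) * h)%:F / (\d_(repr g))%:F.
  by rewrite E [X in X * _ == _]fracE tofracM mulrAC.
rewrite [LHS]fracE => /eqP; rewrite frac_eqE // => /eqP/(congr1 (meval v)).
rewrite !mevalM => {}E; rewrite /rfeval; apply/eqP.
by rewrite mulrAC eqr_div // E.
Qed.

Lemma sasano_not_integrable (K : numClosedFieldType) :
  ~ rationally_integrable (sasano_Hhat (2 / 5) (1 / 5) : {mpoly K[3 + 3]}).
Proof.
move=> [f [fi _ [g g0 indep]]].
pose rho : K := (sqrtC 5)^-1.
have rho_gt0 : 0 < rho by rewrite invr_gt0 sqrtC_gt0 ltr0n.
have rho2 : 5 * rho ^+ 2 = 1 by rewrite exprVn sqrtCK mulfV // pnatr_eq0.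
pose mu1 := sqrtC (2 + 6 * rho); pose mu2 := sqrtC (2 - 6 * rho).
have mu1E : mu1 ^+ 2 = 2 + 6 * rho by exact: sqrtCK.
have mu2E : mu2 ^+ 2 = 2 - 6 * rho by exact: sqrtCK.
have mu1_gt : 0 < mu1 ^+ 2 by rewrite mu1E addr_gt0 ?mulr_gt0 ?ltr0n.
have mu2_lt : mu2 ^+ 2 < 0.
  (* After squaring and multiplying by 5, 2 < 6 rho becomes 20 < 36. *)
  rewrite mu2E subr_lt0 -(@ltr_pXn2r _ 2) ?nnegrE ?ler0n //; last first.
    by rewrite mulr_ge0 ?ler0n // ltW.
  rewrite exprMn -(ltr_pM2l (ltr0n _ 5)) [X in _ < X]mulrCA rho2 mulr1 -!natrX -natrM.
  by rewrite ltr_nat.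
pose iF := pidx (@Ordinal 3 2 isT).
(* All denominators of the Jacobian matrix are avoided along with the zeros of [g]. *)
pose d := \prod_(a < 3) \prod_(i < 3 + 3) \d_(repr (pderiv i (f a))).
have d0 : d != 0.
  by apply/prodf_neq0 => a _; apply/prodf_neq0 => i _; exact: denom_ratioP.
have [v] := mpoly_nonzero_point (mulf_neq0 g0 d0).
rewrite mevalM mulf_eq0 negb_or => /andP[gv dv].
have dv0 a i : (\d_(repr (pderiv i (f a)))).@[v] != 0.
  apply: contraNneq dv => E; rewrite /d (bigD1 a) //= (bigD1 i) //=.
  by rewrite !mevalM E !mul0r.
have := indep v gv.
(* A column times a row has rank at most 1, while independence asks for rank 3. *)
have -> : \matrix_(a < 3, i < 3 + 3) rfeval v (pderiv i (f a)) =
    (\col_a rfeval v (pderiv iF (f a))) *m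
    (\row_i ((sasano_Hhat (2 / 5) (1 / 5))^`M(i)).@[v]).
  apply/matrixP => a i; rewrite !mxE big_ord1 !mxE.
  apply: rfeval_mul; [exact: dv0|exact: dv0|].
  have E := first_integral_gradient rho2 mu1_gt mu2_lt mu1E mu2E i (fi a).
  exact E.
rewrite /row_free; set A := \col_a _; set B := \row_i _ => /eqP rk.
by have : (\rank (A *m B) <= 1)%N := mulmx_max_rank A B; rewrite rk.
Qed.

Theorem theorem1p1 (R : realType) (alpha0 alpha1 alpha2 : R[i])
  (h0 : alpha0 = 2 / 5) (h1 : alpha1 = 1 / 5) (h2 : alpha2 = 1 / 10) :
  ~ rationally_integrable (sasano_Hhat alpha0 alpha1).
Proof. by rewrite h0 h1; exact: (@sasano_not_integrable R[i]). Qed.
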